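(* For two bidders with an arbitrary (possibly correlated) joint valuation distribution given explicitly as a table of rational probabilities over a finite grid of rational values, there is an algorithm that, given the instance and a rational $\epsilon>0$, outputs an $\epsilon$-Pareto set of deterministic mechanisms for the (welfare, revenue) objectives in time polynomial in the instance size and $1/\epsilon$ (i.e. an FPTAS for approximating the Pareto curve).
   Context: Setting: a single indivisible item is sold to $n$ bidders. Bidder $i$ has a private valuation drawn from a finite support $v_i^1<v_i^2<\dots<v_i^{h_i}$; valuation profiles are drawn from a probability mass function $f$ (arbitrary, possibly non-product). A deterministic (ex-post incentive compatible and individually rational) mechanism is given by an allocation matrix $A:[h_1]\times\dots\times[h_n]\to\{0,1,\dots,n\}$ satisfying monotonicity: if $A[i_1,\dots,i_j,\dots,i_n]=j$ then $A[i_1,\dots,k,\dots,i_n]=j$ for every $k\ge i_j$. On profile $(i_1,\dots,i_n)$ with $A=j\ge 1$, bidder $j$ pays $v_j^{k^*}$ where $k^*$ is the least $k$ with $A[i_1,\dots,k,\dots,i_n]=j$; others pay $0$. $\mathrm{SW}(A)=\mathbb{E}[v_{\text{winner}}]$, $\mathrm{Rev}(A)=\mathbb{E}[\text{payment}]$. For $p,q\in\mathbb{R}^2_+$, $p$ $\epsilon$-covers $q$ if $p\ge q/(1+\epsilon)$ coordinatewise. An $\epsilon$-Pareto set is a set of mechanisms whose (SW, Rev) points $\epsilon$-cover the (SW, Rev) point of every deterministic mechanism. *)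

(* Defs.v *)
From HB Require Import structures.
From mathcomp Require Import all_boot all_order all_algebra.
Set Implicit Arguments. Unset Strict Implicit. Unset Printing Implicit Defensive.
Import Order.TTheory GRing.Theory Num.Theory.
Local Open Scope ring_scope.

Inductive Sym := Blank | Zero | One | Sep.
Inductive Move := MoveL | MoveR | Stay.

Definition is_blank (s : Sym) : bool := if s is Blank then true else false.

(* A machine: finite state set, start state, partial transition function;
   the machine halts when the transition function returns None. *)
Record TM := mkTM {
  tm_state : finType;
  tm_start : tm_state;
  tm_delta : tm_state -> Sym -> option (tm_state * Sym * Move)
}.

(* configuration: state, left part of tape (reversed, nearest cell first),
   symbol under the head, right part of tape *)
Definition config (M : TM) := (tm_state M * seq Sym * Sym * seq Sym)%type.

Definition step (M : TM) (c : config M) : option (config M) :=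
  let: (q, l, a, r) := c in
  match tm_delta q a with
  | None => None
  | Some (q', b, m) =>
    Some match m with
    | Stay => (q', l, b, r)
    | MoveL => match l with
               | [::] => (q', [::], Blank, b :: r)
               | x :: l' => (q', l', x, b :: r)
               end
    | MoveR => match r with
               | [::] => (q', b :: l, Blank, [::])
               | x :: r' => (q', b :: l, x, r')
               end
    end
  end.

Definition halted (M : TM) (c : config M) : bool :=
  if step c is None then true else false.

Fixpoint run (M : TM) (n : nat) (c : config M) : config M :=
  match n with
  | 0 => c
  | n'.+1 => match step c with None => c | Some c' => run n' c' end
  end.

Definition init_config (M : TM) (w : seq Sym) : config M :=
  match w with
  | [::] => (tm_start M, [::], Blank, [::])
  | a :: w' => (tm_start M, [::], a, w')
  end.

Definition tm_output (M : TM) (c : config M) : seq Sym :=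
  let: (_, _, a, r) := c in
  let s := a :: r in take (find is_blank s) s.

Definition computes_within (M : TM) (w : seq Sym) (t : nat) (o : seq Sym) :=
  halted (run t (init_config M w)) /\ tm_output (run t (init_config M w)) = o.

(* little-endian binary digits of n (0 is the empty string) *)
Fixpoint bits_aux (fuel n : nat) : seq bool :=
  match fuel with
  | 0 => [::]
  | fuel'.+1 => if n == 0%N then [::] else odd n :: bits_aux fuel' n./2
  end.
Definition bits (n : nat) : seq bool := bits_aux n n.

Definition enc_nat (n : nat) : seq Sym := [seq if b then One else Zero | b <- bits n].

(* doubling code, so that lists of words can be separated by Sep *)
Definition dbl (s : Sym) : seq Sym :=
  match s with
  | Zero => [:: Zero; Zero]
  | One => [:: One; One]
  | Sep => [:: Zero; One]
  | Blank => [:: One; Zero]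
  end.

Definition enc_list (ws : seq (seq Sym)) : seq Sym :=
  flatten [seq flatten (map dbl w) ++ [:: Sep] | w <- ws].

Definition enc_int (z : int) : seq Sym :=
  enc_list [:: enc_nat (z < 0)%R; enc_nat `|z|%N].

Definition enc_rat (q : rat) : seq Sym :=
  enc_list [:: enc_int (numq q); enc_int (denq q)].

(* v1 = [v_1^1 < ... < v_1^{h1}], v2 likewise, f = h1 x h2 table (rows
   indexed by bidder 1's value index) of the joint pmf *)
Record instance := mkInstance {
  val1 : seq rat;
  val2 : seq rat;
  pmf : seq (seq rat)
}.

Definition h1 (I : instance) := size (val1 I).
Definition h2 (I : instance) := size (val2 I).
Definition f_at (I : instance) (i j : nat) : rat := nth 0 (nth [::] (pmf I) i) j.

Definition wf_instance (I : instance) : Prop :=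
  [/\ (0 < h1 I)%N /\ (0 < h2 I)%N,
      sorted <%R (val1 I) /\ sorted <%R (val2 I),
      all (fun x => 0 <= x) (val1 I) /\ all (fun x => 0 <= x) (val2 I),
      size (pmf I) = h1 I /\ all (fun row => size row == h2 I) (pmf I) &
      (forall i j, (i < h1 I)%N -> (j < h2 I)%N -> 0 <= f_at I i j) /\
      \sum_(i < h1 I) \sum_(j < h2 I) f_at I i j = 1].

(* allocation matrix: h1 x h2 table with entries in {0,1,2}; 0 = unsold *)
Definition mech := seq (seq nat).
Definition A_at (A : mech) (i j : nat) : nat := nth 0%N (nth [::] A i) j.

Definition is_mechanism (I : instance) (A : mech) : Prop :=
  [/\ size A = h1 I,
      all (fun row => size row == h2 I) A,
      (forall i j, (i < h1 I)%N -> (j < h2 I)%N -> (A_at A i j <= 2)%N),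
      (forall i j k, (i <= k < h1 I)%N -> (j < h2 I)%N ->
          A_at A i j = 1%N -> A_at A k j = 1%N) &
      (forall i j k, (i < h1 I)%N -> (j <= k < h2 I)%N ->
          A_at A i j = 2%N -> A_at A i k = 2%N)].

Definition winner_value (I : instance) (A : mech) (i j : nat) : rat :=
  match A_at A i j with
  | 1%N => nth 0 (val1 I) i
  | 2%N => nth 0 (val2 I) j
  | _ => 0
  end.

Definition payment (I : instance) (A : mech) (i j : nat) : rat :=
  match A_at A i j with
  | 1%N => nth 0 (val1 I) (find (fun k => A_at A k j == 1%N) (iota 0 (h1 I)))
  | 2%N => nth 0 (val2 I) (find (fun k => A_at A i k == 2%N) (iota 0 (h2 I)))
  | _ => 0
  end.

Definition SW (I : instance) (A : mech) : rat :=
  \sum_(i < h1 I) \sum_(j < h2 I) f_at I i j * winner_value I A i j.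

Definition Rev (I : instance) (A : mech) : rat :=
  \sum_(i < h1 I) \sum_(j < h2 I) f_at I i j * payment I A i j.

Definition covers (eps : rat) (p q : rat * rat) : Prop :=
  q.1 / (1 + eps) <= p.1 /\ q.2 / (1 + eps) <= p.2.

Definition point (I : instance) (A : mech) : rat * rat := (SW I A, Rev I A).

Definition eps_pareto_set (I : instance) (eps : rat) (P : seq mech) : Prop :=
  (forall A, A \in P -> is_mechanism I A) /\
  (forall B, is_mechanism I B -> exists2 A, A \in P & covers eps (point I A) (point I B)).

Definition enc_input (I : instance) (eps : rat) : seq Sym :=
  enc_list [:: enc_list (map enc_rat (val1 I));
               enc_list (map enc_rat (val2 I));
               enc_list [seq enc_list (map enc_rat row) | row <- pmf I];
               enc_rat eps].

Definition enc_mech (A : mech) : seq Sym :=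
  enc_list [seq enc_list (map enc_nat row) | row <- A].

Definition enc_output (P : seq mech) : seq Sym := enc_list (map enc_mech P).

(* Main.v *)
Require Import Defs.
From HB Require Import structures.
From mathcomp Require Import all_boot all_order all_algebra.
From mathcomp Require Import zify ring lra.
From Stdlib Require Import FunctionalExtensionality.
Import Order.TTheory GRing.Theory Num.Theory.
Set Implicit Arguments. Unset Strict Implicit. Unset Printing Implicit Defensive.

(** A mechanism gives bidder 1 an up-closed set of rows in each column j, with threshold
    [a j], and bidder 2 an up-closed set of columns in each row i, with threshold [b i].
    Disjointness of the two regions means that the thresholds are those of a monotone lattice
    path from (0, 0) to (h1, h2): a path at (i, g) either crosses column g, choosing any
    [a g >= i], or crosses row i, choosing any [b i >= g].  Welfare and revenue are sums of
    one weight per crossed line, so the Pareto curve is that of a two-criteria longest path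
    problem in a grid.  Guess the largest weights S and R occurring on the path in the two
    criteria, discard the lines exceeding them and round the others down to multiples of S / M
    and R / M with M = (h1 + h2) K, where K >= 1 + 1 / eps.  A path loses at most S / K, which
    is at most a fraction 1 / K of its value because S occurs on it, and only polynomially many
    rounded states remain.

    To obtain a Turing machine, words are kept as a stack on the tape, separated by blanks,
    and every program works on the top word without touching the tape to its left.  The
    functions computed in this way in polynomial time are closed under composition, pairing,
    case distinction and folds with polynomially bounded accumulators. *)

(** * Structured tape programs *)

(** All cells that a bidder wins in one line are charged the same value, the one at the threshold,
    so revenue as well as welfare is additive over lines. What may follow at a point of the path
    depends on that point only, so one representative per point and pair of rounded totals is
    enough. The lines carrying S and R may differ, hence two independent guesses; and K >= 1 + 1 /
    eps says exactly that 1 - 1 / K >= 1 / (1 + eps).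

    On the machine side the obstacle is 1 / eps: it may be exponential in the length of the binary
    input, while a fold iterates only over a list whose length is polynomial in that input. The
    algorithm is therefore shown polynomial in the pair of the input and K written in unary, and a
    single hand-made loop outside the closure calculus produces this unary word. Sizes of outputs
    are read off from running times, so composition needs no separate size analysis; only the
    accumulators of folds do. *)

Definition stream := nat -> Sym.
Definition scons (s : Sym) (R : stream) : stream :=
  fun i => if i is i'.+1 then R i' else s.
Definition stl (R : stream) : stream := fun i => R i.+1.
Definition blanks : stream := fun _ => Blank.
Definition prep (w : seq Sym) (R : stream) : stream := foldr scons R w.
Notation "w +++ R" := (prep w R) (at level 60, right associativity).

(** With a stream to the right, tapes that differ only by explicit trailing blanks are equal, by
    functional extensionality; the finite lists of a configuration would distinguish them. *)
Definition tape := (seq Sym * stream)%type.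

Definition act (s : Sym) (m : Move) (t : tape) : tape :=
  match m with
  | Stay => (t.1, scons s (stl t.2))
  | MoveR => (s :: t.1, stl t.2)
  | MoveL => (behead t.1, scons (head Blank t.1) (scons s (stl t.2)))
  end.

Inductive prog :=
  | Act of (Sym -> Sym) & Move
  | Seq of prog & prog
  | If of (Sym -> bool) & prog & prog
  | While of (Sym -> bool) & prog.

(** The counts are exact for the compiled machine: one more step for each hand-over between
    components, and none for a failing loop test, on which the machine halts. *)
Inductive exec : prog -> tape -> nat -> tape -> Prop :=
  | EAct f m t : exec (Act f m) t 1 (act (f (t.2 0)) m t)
  | ESeq p q t n t1 n' t2 :
      exec p t n t1 -> exec q t1 n' t2 -> exec (Seq p q) t (n + n').+1 t2
  | EIfT (b : Sym -> bool) p q t n t' : b (t.2 0) -> exec p t n t' -> exec (If b p q) t n.+1 t'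
  | EIfF (b : Sym -> bool) p q t n t' :
      ~~ b (t.2 0) -> exec q t n t' -> exec (If b p q) t n.+1 t'
  | EWhileF (b : Sym -> bool) p t : ~~ b (t.2 0) -> exec (While b p) t 0 t
  | EWhileT (b : Sym -> bool) p t n t1 n' t2 :
      b (t.2 0) -> exec p t n t1 -> exec (While b p) t1 n' t2 ->
      exec (While b p) t (n + n').+2 t2.

Definition actTM (f : Sym -> Sym) (m : Move) : TM :=
  @mkTM bool true
    (fun q a => if q then Some (false, f a, m) else None).

Definition seqTM (M N : TM) : TM :=
  @mkTM (tm_state M + tm_state N)%type (inl (tm_start M))
    (fun q a => match q with
      | inl q1 => match tm_delta q1 a with
                  | Some (q1', s, m) => Some (inl q1', s, m)
                  | None => Some (inr (tm_start N), a, Stay)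
                  end
      | inr q2 => match tm_delta q2 a with
                  | Some (q2', s, m) => Some (inr q2', s, m)
                  | None => None
                  end
      end).

Definition ifTM (b : Sym -> bool) (M N : TM) : TM :=
  @mkTM (option (tm_state M + tm_state N)%type) None
    (fun q a => match q with
      | None => Some (Some (if b a then inl (tm_start M) else inr (tm_start N)),
                      a, Stay)
      | Some (inl q1) => match tm_delta q1 a with
                  | Some (q1', s, m) => Some (Some (inl q1'), s, m)
                  | None => None
                  end
      | Some (inr q2) => match tm_delta q2 a with
                  | Some (q2', s, m) => Some (Some (inr q2'), s, m)
                  | None => None
                  end
      end).

Definition whileTM (b : Sym -> bool) (M : TM) : TM :=
  @mkTM (option (tm_state M)) None
    (fun q a => match q with
      | None => if b a then Some (Some (tm_start M), a, Stay) else None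
      | Some q1 => match tm_delta q1 a with
                  | Some (q1', s, m) => Some (Some q1', s, m)
                  | None => Some (None, a, Stay)
                  end
      end).

Fixpoint compile (p : prog) : TM :=
  match p with
  | Act f m => actTM f m
  | Seq p q => seqTM (compile p) (compile q)
  | If b p q => ifTM b (compile p) (compile q)
  | While b p => whileTM b (compile p)
  end.

(** * Simulation of tape programs by Turing machines *)

Section Reach.
Variable M : TM.

Inductive reach : nat -> tm_state M * tape -> tm_state M * tape -> Prop :=
  | Reach0 x : reach 0 x x
  | ReachS q t q' s m n y : tm_delta q (t.2 0) = Some (q', s, m) ->
      reach n (q', act s m t) y -> reach n.+1 (q, t) y.

Lemma reach_trans n1 n2 x y z :
  reach n1 x y -> reach n2 y z -> reach (n1 + n2) x z.
Proof.
elim=> [//|q t q' s m n y' dq _ IH yz].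
by rewrite addSn; apply: ReachS dq _; apply: IH.
Qed.

(* A concrete configuration lists only finitely many cells of the right half tape. *)
Definition represents (c : config M) (x : tm_state M * tape) :=
  let: (q, l, a, r) := c in
  [/\ q = x.1, l = x.2.1 & forall i, nth Blank (a :: r) i = x.2.2 i].

Lemma represents_step c q t q' s m :
  represents c (q, t) -> tm_delta q (t.2 0) = Some (q', s, m) ->
  exists2 c', step c = Some c' & represents c' (q', act s m t).
Proof.
case: c => [[[q0 l] a] r]; case: t => L R /= [-> -> eqR].
rewrite -(eqR 0) /= => ->; case: m.
- case: L => [|x L]; eexists; first by [].
  + by split=> //= -[|[|i]] //=; rewrite /stl -eqR.
  + by [].
  + by split=> //= -[|[|i]] //=; rewrite /stl -eqR.
- case: r eqR => [|x r] eqR; eexists; first by [].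
  + by split=> //= i; rewrite /stl -eqR /=; case: i => [|i] /=; rewrite ?nth_nil.
  + by [].
  + by split=> //= i; rewrite /stl -eqR.
- eexists; first by [].
  by split=> //= -[|i] //=; rewrite /stl -eqR.
Qed.

Lemma reach_run n x y c : reach n x y -> represents c x ->
  tm_delta y.1 (y.2.2 0) = None ->
  represents (run n c) y /\ halted (run n c).
Proof.
move=> r; elim: r c => {n x y} [[q t]|q t q' s m n y dq _ IH] c rc dN.
  split=> //; case: c rc => [[[q0 l] a] r] /= [-> _ eqR].
  by move: (eqR 0) dN => /= <- dN; rewrite /halted /= dN.
have [c' /= -> rc'] := represents_step rc dq.
exact: IH.
Qed.

End Reach.

Lemma reach_lift (M N : TM) (f : tm_state M -> tm_state N) :
  (forall q a q' s m, tm_delta q a = Some (q', s, m) ->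
     tm_delta (f q) a = Some (f q', s, m)) ->
  forall n x y, reach n x y -> reach n (f x.1, x.2) (f y.1, y.2).
Proof.
move=> fP n x y; elim=> [z|q t q' s m n' z dq _ IH]; first exact: Reach0.
by apply: ReachS (fP _ _ _ _ _ dq) IH.
Qed.

Lemma scons_eta R : scons (R 0) (stl R) = R.
Proof. by apply: functional_extensionality => -[]. Qed.

Lemma act_stay t : act (t.2 0) Stay t = t.
Proof. by case: t => L R; rewrite /act /= scons_eta. Qed.

Lemma reach_stay M (q q' : tm_state M) t n y :
  tm_delta q (t.2 0) = Some (q', t.2 0, Stay) -> reach n (q', t) y ->
  reach n.+1 (q, t) y.
Proof. by move=> dq r; apply: ReachS dq _; rewrite act_stay. Qed.

(** That the machine is stuck on the final tape is part of the induction: [seqTM] and [whileTM]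
    recognise the end of a component by its missing transition. *)
Lemma exec_reach p t n t' : exec p t n t' ->
  exists2 q, reach n (tm_start (compile p), t) (q, t') &
             tm_delta q (t'.2 0) = None.
Proof.
elim=> {p t n t'}.
- move=> f m t; exists (false : tm_state (actTM f m)) => //.
  exact: (@ReachS (actTM f m) true t false (f (t.2 0)) m 0 _ erefl (Reach0 _)).
- move=> p q t n t1 n' t2 _ [q1 r1 d1] _ [q2 r2 d2].
  exists (inr q2 : tm_state (seqTM (compile p) (compile q))); last by rewrite /= d2.
  rewrite -addnS.
  apply: reach_trans (reach_lift (N := seqTM _ _) (f := inl) _ r1) _.
    by move=> q0 a q' s m /= ->.
  apply: reach_stay; first by rewrite /= d1.
  by apply: (reach_lift (N := seqTM _ _) (f := inr) _ r2) => q0 a q' s m /= ->.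
- move=> b p q t n t' bt _ [q1 r1 d1].
  exists (Some (inl q1) : tm_state (ifTM b (compile p) (compile q)));
    last by rewrite /= d1.
  apply: reach_stay; first by rewrite /= bt.
  by apply: (reach_lift (N := ifTM _ _ _) (f := Some \o inl) _ r1) => q0 a q' s m /= ->.
- move=> b p q t n t' bt _ [q1 r1 d1].
  exists (Some (inr q1) : tm_state (ifTM b (compile p) (compile q)));
    last by rewrite /= d1.
  apply: reach_stay; first by rewrite /= (negPf bt).
  by apply: (reach_lift (N := ifTM _ _ _) (f := Some \o inr) _ r1) => q0 a q' s m /= ->.
- move=> b p t bt; exists (None : tm_state (whileTM b (compile p))); first exact: Reach0.
  by rewrite /= (negPf bt).
- move=> b p t n t1 n' t2 bt _ [q1 r1 d1] _ [q2 r2 d2].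
  exists q2 => //; apply: reach_stay; first by rewrite /= bt.
  rewrite -addnS.
  apply: reach_trans (reach_lift (N := whileTM _ _) (f := Some) _ r1) _.
    by move=> q0 a q' s m /= ->.
  by apply: reach_stay r2; rewrite /= d1.
Qed.

(** * Stack operations *)

Definition runs p t n t' := exists2 m, m <= n & exec p t m t'.

(** The base is at least 2, so sums, products and constants are absorbed by the exponent. Exponents
    are then composed mechanically and left to unification after [eexists]. *)
Definition polyruns (c s : nat) p t t' := runs p t (s.+2 ^ c) t'.

Lemma polyruns_exp c c' s p t t' :
  polyruns c s p t t' -> c <= c' -> polyruns c' s p t t'.
Proof. by case=> m mle e le; exists m => //; apply: leq_trans mle _; rewrite leq_exp2l. Qed.

Lemma add2_expn s d : s.+2 ^ d + 2 <= s.+2 ^ d.+2.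
Proof.
rewrite !expnS; have : 0 < s.+2 ^ d by rewrite expn_gt0.
nia.
Qed.

Lemma polyruns_scale d c s s' p t t' :
  polyruns c s' p t t' -> s' <= s.+2 ^ d -> polyruns (d.+2 * c) s p t t'.
Proof.
case=> m mle e le; exists m => //; apply: leq_trans mle _.
rewrite expnM; case: c => // c; rewrite leq_exp2r //.
by apply: leq_trans (add2_expn _ _); rewrite addn2 !ltnS.
Qed.

Lemma polyruns_size c s s' p t t' :
  polyruns c s' p t t' -> s' <= s -> polyruns c s p t t'.
Proof.
case=> m mle e le; exists m => //; apply: leq_trans mle _.
by case: c => // c; rewrite leq_exp2r.
Qed.

Lemma polyruns_seq c1 c2 s p q t t1 t2 :
  polyruns c1 s p t t1 -> polyruns c2 s q t1 t2 ->
  polyruns (c1 + c2).+2 s (Seq p q) t t2.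
Proof.
case=> m mle e [m' mle' e']; exists (m + m').+1; last exact: ESeq e e'.
apply: leq_trans (_ : s.+2 ^ c1 + s.+2 ^ c2 < _); first by rewrite ltnS leq_add.
have l1 : 0 < s.+2 ^ c1 by rewrite expn_gt0.
have l2 : 0 < s.+2 ^ c2 by rewrite expn_gt0.
by rewrite !expnS expnD; nia.
Qed.

Lemma polyruns_act f m s t : polyruns 0 s (Act f m) t (act (f (t.2 0)) m t).
Proof. by exists 1 => //; apply: EAct. Qed.

Lemma polyruns_ifT c s (b : Sym -> bool) p q t t' :
  b (t.2 0) -> polyruns c s p t t' -> polyruns c.+1 s (If b p q) t t'.
Proof.
move=> bt [m mle e]; exists m.+1; last exact: EIfT.
by apply: leq_ltn_trans mle _; rewrite ltn_exp2l.
Qed.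

Lemma polyruns_ifF c s (b : Sym -> bool) p q t t' :
  ~~ b (t.2 0) -> polyruns c s q t t' -> polyruns c.+1 s (If b p q) t t'.
Proof.
move=> bt [m mle e]; exists m.+1; last exact: EIfF.
by apply: leq_ltn_trans mle _; rewrite ltn_exp2l.
Qed.

(** Loop rule for a traversal of [x]: [J u v] is the tape when the prefix [u] is done and [v]
    remains. There are at most [s] rounds, which costs only a bounded increase of the exponent. *)
Lemma polyruns_while (T : Type) (b : Sym -> bool) p (J : seq T -> seq T -> tape) x c s :
  size x <= s ->
  (forall u a v, x = u ++ a :: v ->
     b ((J u (a :: v)).2 0) /\
     polyruns c s p (J u (a :: v)) (J (rcons u a) v)) ->
  ~~ b ((J x [::]).2 0) ->
  polyruns c.+3 s (While b p) (J [::] x) (J x [::]).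
Proof.
move=> xs step stop.
have key v : forall u, x = u ++ v ->
    runs (While b p) (J u v) (size v * (s.+2 ^ c + 2)) (J x [::]).
  elim: v => [|a v IH] u xE.
    exists 0 => //; rewrite xE cats0; apply: EWhileF.
    by rewrite -[u]cats0 -xE.
  have [bt [m mle e]] := step _ _ _ xE.
  have [|m' mle' e'] := IH (rcons u a); first by rewrite cat_rcons.
  exists (m + m').+2; last exact: EWhileT e e'.
  rewrite /= mulSn; move: mle mle'.
  by move: (s.+2 ^ c) (size v * _) => A B; lia.
have [m mle e] := key x [::] erefl.
exists m => //; apply: leq_trans mle _; rewrite expnS leq_mul ?add2_expn //.
by apply: leq_trans xs _; apply: leq_trans (leqnSn _) (leqnSn _).
Qed.

Definition nb (s : Sym) : bool := ~~ is_blank s.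
Definition clean (w : seq Sym) : bool := all nb w.

Lemma clean_cat u v : clean (u ++ v) = clean u && clean v.
Proof. exact: all_cat. Qed.

Lemma clean_rev w : clean (rev w) = clean w.
Proof. exact: all_rev. Qed.

Lemma prep_cat u v R : (u ++ v) +++ R = u +++ (v +++ R).
Proof. exact: foldr_cat. Qed.

Lemma prep_rcons u a R : rcons u a +++ R = u +++ scons a R.
Proof. by rewrite -cats1 prep_cat. Qed.

Lemma scons_blank : scons Blank blanks = blanks.
Proof. exact: (scons_eta blanks). Qed.

Definition mvL := Act id MoveL.
Definition mvR := Act id MoveR.

Lemma polyruns_mvR s L R : polyruns 0 s mvR (L, R) (R 0 :: L, stl R).
Proof. exact: polyruns_act. Qed.

Lemma polyruns_mvL s x L R : polyruns 0 s mvL (x :: L, R) (L, scons x R).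
Proof. by have := polyruns_act id MoveL s (x :: L, R); rewrite /act /= scons_eta. Qed.

(* The head stands on the first symbol of the top word, which is the rightmost one on the tape. *)
Definition stk1 (L x : seq Sym) : tape := (Blank :: L, x +++ blanks).
Definition stk2 L x y := stk1 (rev x ++ Blank :: L) y.
Definition stk3 L x y z := stk2 (rev x ++ Blank :: L) y z.

Definition scanR := While nb mvR.

Lemma scanR_spec s L w R : size w <= s -> clean w -> ~~ nb (R 0) ->
  polyruns 3 s scanR (L, w +++ R) (rev w ++ L, R).
Proof.
move=> ws cw bR.
pose J u v : tape := (rev u ++ L, v +++ R).
apply: (@polyruns_while _ _ _ J w 0 s ws _ bR) => u a v wE.
split; first by move: cw; rewrite wE /clean all_cat /= => /and3P[].
by rewrite /J rev_rcons; apply: polyruns_mvR.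
Qed.

Definition toSep := Seq mvL (While nb mvL).

Lemma toSep_spec s L w R : size w <= s -> clean w ->
  polyruns 5 s toSep (rev w ++ Blank :: L, R) (L, scons Blank (w +++ R)).
Proof.
move=> ws cw; set x := rev w.
pose J u v : tape :=
  (behead (v ++ Blank :: L), scons (head Blank (v ++ Blank :: L)) (rev u +++ R)).
have m1 : polyruns 0 s mvL (x ++ Blank :: L, R) (J [::] x).
  by rewrite /J /=; case: x => [|a x]; apply: polyruns_mvL.
have m2 : polyruns 3 s (While nb mvL) (J [::] x) (J x [::]).
  apply: polyruns_while => [|u a v xE|//]; first by rewrite size_rev.
  split; first by move: cw; rewrite -clean_rev -/x xE clean_cat /= => /and3P[].
  rewrite /J rev_rcons /=; case: v {xE} => [|a' v] /=; exact: polyruns_mvL.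
by have := polyruns_seq m1 m2; rewrite /J revK.
Qed.

Definition home := Seq toSep mvR.

Lemma home_spec s L w R : size w <= s -> clean w ->
  polyruns 7 s home (rev w ++ Blank :: L, R) (Blank :: L, w +++ R).
Proof. by move=> ws cw; apply: polyruns_seq (toSep_spec _ _ ws cw) (polyruns_mvR _ _ _). Qed.

Definition prev := Seq mvL home.

Lemma prev_spec s L x R : size x <= s -> clean x ->
  polyruns 9 s prev (Blank :: rev x ++ Blank :: L, R) (Blank :: L, x +++ scons Blank R).
Proof. by move=> xs cx; apply: polyruns_seq (polyruns_mvL _ _ _ _) (home_spec _ _ xs cx). Qed.

Definition opNew := Seq scanR mvR.

Lemma opNew_spec s L x : size x <= s -> clean x ->
  polyruns 5 s opNew (stk1 L x) (stk2 L x [::]).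
Proof. by move=> xs cx; apply: polyruns_seq (scanR_spec _ xs cx _) (polyruns_mvR _ _ _). Qed.

Definition opApp a := Seq scanR (Seq (Act (fun _ => a) Stay) home).

Lemma opApp_spec s L x a : size x <= s -> clean x ->
  polyruns 14 s (opApp a) (stk1 L x) (stk1 L (rcons x a)).
Proof.
move=> xs cx; apply: polyruns_seq (scanR_spec _ xs cx _) _ => //.
apply: (@polyruns_seq 0 7); first exact: polyruns_act.
by rewrite /stk1 prep_rcons; apply: home_spec.
Qed.

(** Programs have no registers: the symbol read is remembered by branching into a separate copy of
    [F]. *)
Definition on_sym (F : Sym -> prog) :=
  If (fun s => if s is Zero then true else false) (F Zero)
    (If (fun s => if s is One then true else false) (F One) (F Sep)).

Lemma on_sym_spec c s F a t t' : t.2 0 = a -> nb a ->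
  polyruns c s (F a) t t' -> polyruns c.+2 s (on_sym F) t t'.
Proof.
move=> ta na r; case: a ta na r => // ta _ r.
- by apply: polyruns_exp (leqnSn _); apply: polyruns_ifT r; rewrite ta.
- by apply: polyruns_ifF; rewrite ?ta //; apply: polyruns_ifT r; rewrite ta.
- by apply: polyruns_ifF; rewrite ?ta //; apply: polyruns_ifF r; rewrite ta.
Qed.

(* Moves a word one cell to the left, over the blank that precedes it. *)
Definition shiftL :=
  While nb (on_sym (fun a =>
    Seq (Act (fun _ => Blank) MoveL) (Seq (Act (fun _ => a) MoveR) mvR))).

Lemma shiftL_spec s L x R : size x <= s -> clean x -> ~~ nb (R 0) ->
  polyruns 9 s shiftL (Blank :: L, x +++ R) (Blank :: rev x ++ L, R).
Proof.
move=> xs cx bR.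
pose J u v : tape := (Blank :: rev u ++ L, v +++ R).
apply: (@polyruns_while _ _ _ J x 6 s xs _ bR) => u a v xE.
have na : nb a by move: cx; rewrite xE clean_cat /= => /and3P[].
split=> //; apply: (on_sym_spec (a := a)) => //.
apply: (@polyruns_seq 0 2); first exact: polyruns_act.
apply: (@polyruns_seq 0 0); first exact: polyruns_act.
by rewrite /J rev_rcons; apply: polyruns_mvR.
Qed.

Definition opJoin := Seq shiftL (Seq mvL home).

Lemma opJoin_spec s L x y : size x + size y <= s -> clean x -> clean y ->
  polyruns 20 s opJoin (stk2 L x y) (stk1 L (x ++ y)).
Proof.
move=> xys cx cy.
apply: polyruns_seq (shiftL_spec _ _ cy _) _ => //; first by lia.
apply: (@polyruns_seq 0 7); first exact: polyruns_mvL.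
rewrite scons_blank catA -rev_cat; apply: home_spec; first by rewrite size_cat.
by rewrite clean_cat; apply/andP.
Qed.

Definition opPop := Seq (Act (fun _ => Blank) MoveR) opJoin.

Lemma opPop_spec s L a x : size x <= s -> clean x ->
  polyruns 22 s opPop (stk1 L (a :: x)) (stk1 L x).
Proof.
move=> xs cx; apply: (@polyruns_seq 0 20); first exact: polyruns_act.
exact: (@opJoin_spec _ _ [::]).
Qed.

(** The lower word is deleted letter by letter. Each round blanks its first letter, then moves the
    rest of it and the upper word one cell to the left, so the stack below stays untouched. *)
Definition opNip :=
  Seq prev
    (Seq (While nb
      (Seq (Act (fun _ => Blank) MoveR)
        (Seq shiftL (Seq mvR (Seq shiftL (Seq mvL (Seq home prev)))))))
      (Seq mvR opJoin)).

Lemma opNip_spec : exists c, forall s L x y,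
  size x <= s -> size y <= s -> clean x -> clean y ->
  polyruns c s opNip (stk2 L x y) (stk1 L y).
Proof.
eexists => s L x y xs ys cx cy.
apply: polyruns_seq; first exact: prev_spec xs cx.
pose J (u v : seq Sym) : tape := (Blank :: L, v +++ scons Blank (y +++ blanks)).
apply: (@polyruns_seq _ _ _ _ _ _ (J x [::])).
  apply: (@polyruns_while _ _ _ J x _ s xs) => // u a v xE.
  have [na cv] : nb a /\ clean v by move: cx; rewrite xE clean_cat /= => /and3P[].
  have vs : size v <= s by move: xs; rewrite xE size_cat /=; lia.
  split=> //; apply: polyruns_seq; first exact: polyruns_act.
  apply: polyruns_seq; first exact: shiftL_spec.
  apply: polyruns_seq; first exact: polyruns_mvR.
  apply: polyruns_seq; first exact: shiftL_spec.
  apply: polyruns_seq; first exact: polyruns_mvL.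
  rewrite scons_blank.
  apply: polyruns_seq; first exact: home_spec.
  exact: prev_spec.
apply: polyruns_seq; first exact: polyruns_mvR.
exact: (@opJoin_spec s _ [::]).
Qed.

Definition opErase := Seq scanR (Seq mvL (While nb (Act (fun _ => Blank) MoveL))).

Lemma opErase_spec : exists c, forall s L x, size x <= s -> clean x ->
  polyruns c s opErase (stk1 L x) (L, blanks).
Proof.
eexists => s L x xs cx; apply: polyruns_seq; first exact: scanR_spec.
pose J (u v : seq Sym) : tape :=
  (behead (v ++ Blank :: L), scons (head Blank (v ++ Blank :: L)) blanks).
apply: (@polyruns_seq _ _ _ _ _ _ (J [::] (rev x))).
  rewrite /J /=; case: (rev x) => [|a z]; exact: polyruns_mvL.
have -> : (L, blanks) = J (rev x) [::] by rewrite /J /= scons_blank.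
apply: polyruns_while => [|u a v xE|//]; first by rewrite size_rev.
split; first by move: cx; rewrite -clean_rev xE clean_cat /= => /and3P[].
have -> : J (rcons u a) v = act Blank MoveL (J u (a :: v)).
  by rewrite /J /act /= /stl /= scons_blank; case: v {xE}.
exact: polyruns_act.
Qed.

Definition opDrop := Seq opErase home.

Lemma opDrop_spec : exists c, forall s L x y, size x <= s -> size y <= s ->
  clean x -> clean y -> polyruns c s opDrop (stk2 L x y) (stk1 L x).
Proof.
have [c erase] := opErase_spec.
eexists => s L x y xs ys cx cy; apply: polyruns_seq; first exact: erase.
exact: home_spec.
Qed.

Definition opClear := Seq opErase mvR.

Lemma opClear_spec : exists c, forall s L x, size x <= s -> clean x ->
  polyruns c s opClear (stk1 L x) (stk1 L [::]).
Proof.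
Proof.
have [c erase] := opErase_spec.
eexists => s L x xs cx; apply: polyruns_seq; first exact: erase.
exact: polyruns_mvR.
Qed.

Definition not_sep (s : Sym) : bool := if s is Sep then false else true.

Definition opSplit := Seq (While not_sep mvR) (Act (fun _ => Blank) MoveR).

Lemma opSplit_spec s L x y : size x <= s -> all not_sep x ->
  polyruns 5 s opSplit (stk1 L (x ++ Sep :: y)) (stk2 L x y).
Proof.
move=> xs nx; rewrite /stk1 prep_cat.
pose J (u v : seq Sym) : tape := (rev u ++ Blank :: L, v +++ (Sep :: y) +++ blanks).
apply: (@polyruns_seq 3 0 _ _ _ _ (J x [::])); last exact: polyruns_act.
apply: (@polyruns_while _ _ _ J) => // u a v xE.
split; first by move: nx; rewrite xE all_cat /= => /and3P[].
by rewrite /J rev_rcons; apply: polyruns_mvR.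
Qed.

Fixpoint write_word (w : seq Sym) : prog :=
  if w is a :: w' then Seq (Act (fun _ => a) MoveR) (write_word w') else Act id Stay.

Lemma write_word_spec w : exists c, forall s L,
  polyruns c s (write_word w) (L, blanks) (rev w ++ L, blanks).
Proof.
elim: w => [|a w [c IH]].
  eexists => s L; have := polyruns_act id Stay s (L, blanks).
  by rewrite act_stay; apply.
eexists => s L; apply: polyruns_seq; first exact: polyruns_act.
by rewrite rev_cons cat_rcons; apply: IH.
Qed.

(* The symbol being copied is replaced by a blank, which marks the place to return to. *)
Definition opCopy (h : Sym -> seq Sym) :=
  Seq prev (Seq prev (Seq
    (While nb (on_sym (fun a =>
       Seq (Act (fun _ => Blank) MoveR)
      (Seq scanR (Seq mvR (Seq scanR (Seq mvR (Seq scanR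
      (Seq (write_word (h a))
      (Seq toSep (Seq toSep (Seq toSep (Act (fun _ => a) MoveR)))))))))))))
    (Seq mvR (Seq scanR mvR)))).

Lemma size_flatten_map_le (T U : Type) (h : T -> seq U) k (w : seq T) :
  (forall a, size (h a) <= k) -> size (flatten (map h w)) <= k * size w.
Proof.
move=> hk; elim: w => //= a w IH; rewrite size_cat mulnS.
exact: leq_add.
Qed.

Lemma clean_flatten_map (T : Type) (h : T -> seq Sym) (w : seq T) :
  (forall a, clean (h a)) -> clean (flatten (map h w)).
Proof. by move=> ch; elim: w => //= a w IH; rewrite clean_cat; apply/andP. Qed.

Lemma sym_fun_bounded (h : Sym -> seq Sym) : exists k, forall a, size (h a) <= k.
Proof.
exists (size (h Blank) + size (h Zero) + size (h One) + size (h Sep)).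
by case; lia.
Qed.

Lemma mul_le_expn k s : k * s <= s.+2 ^ k.+2.
Proof.
rewrite expnSr leq_mul //; last by lia.
apply: leq_trans (ltnW (ltn_expl k (ltnSn 1))) _; rewrite expnS.
have : 2 ^ k <= s.+2 ^ k by case: (k) => // k'; rewrite leq_exp2r.
by nia.
Qed.

Lemma opCopy_spec h : (forall a, clean (h a)) -> exists c, forall s L x y z,
  size x <= s -> size y <= s -> size z <= s -> clean x -> clean y -> clean z ->
  polyruns c s (opCopy h) (stk3 L x y z) (stk3 L x y (z ++ flatten (map h x))).
Proof.
move=> ch.
have [k hk] := sym_fun_bounded h.
have [c wr] : exists c, forall a s L, nb a ->
    polyruns c s (write_word (h a)) (L, blanks) (rev (h a) ++ L, blanks).
  have [c0 H0] := write_word_spec (h Zero).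
  have [c1 H1] := write_word_spec (h One).
  have [c2 H2] := write_word_spec (h Sep).
  exists (c0 + c1 + c2) => -[] // s L _.
  - by apply: polyruns_exp (H0 _ _) _; lia.
  - by apply: polyruns_exp (H1 _ _) _; lia.
  - by apply: polyruns_exp (H2 _ _) _; lia.
eexists => s L x y z xs ys zs cx cy cz.
(* Each letter of [x] writes at most [k] letters, so this also bounds the growing third word. *)
set s' := k.+1 * s.
have ss' : s <= s' by rewrite /s' mulSn leq_addr.
apply: (@polyruns_scale k.+3 _ _ s'); last exact: mul_le_expn.
apply: polyruns_seq; first by apply: prev_spec => //; exact: leq_trans ys ss'.
apply: polyruns_seq; first by apply: prev_spec => //; exact: leq_trans xs ss'.
pose J (u v : seq Sym) : tape :=
  (rev u ++ Blank :: L,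
   v +++ scons Blank (y +++ scons Blank ((z ++ flatten (map h u)) +++ blanks))).
apply: (@polyruns_seq _ _ _ _ _ _ (J x [::])); last first.
  apply: polyruns_seq; first exact: polyruns_mvR.
  apply: polyruns_seq; first by apply: scanR_spec => //; exact: leq_trans ys ss'.
  exact: polyruns_mvR.
have -> : (Blank :: L, x +++ scons Blank (y +++ scons Blank (z +++ blanks))) = J [::] x.
  by rewrite /J /= cats0.
apply: polyruns_while; [exact: leq_trans xs ss' | | by []] => u a v xE.
have [na cv cu] : [/\ nb a, clean v & clean u].
  by move: cx; rewrite xE clean_cat /= => /and3P[].
have [vs us] : size v <= s' /\ (size u).+1 <= s.
  by move: xs; rewrite xE size_cat /= => xs; split; last lia; apply: leq_trans ss'; lia.
split => //; apply: (on_sym_spec (a := a)) => //.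
pose Z := z ++ flatten (map h u); pose Z' := z ++ flatten (map h (rcons u a)).
rewrite /J -/Z -/Z'.
have Z'E : Z' = Z ++ h a by rewrite /Z' map_rcons flatten_rcons catA.
have cZ : clean Z by rewrite clean_cat cz; apply: clean_flatten_map.
have cZ' : clean Z' by rewrite clean_cat cz; apply: clean_flatten_map.
have Z's : size Z' <= s'.
  rewrite size_cat /s' mulSn leq_add //.
  apply: leq_trans (size_flatten_map_le _ hk) _.
  by rewrite size_rcons leq_mul2l us orbT.
have Zs : size Z <= s' by apply: leq_trans Z's; rewrite Z'E size_cat leq_addr.
have ys' : size y <= s' := leq_trans ys ss'.
apply: polyruns_seq; first exact: polyruns_act.
apply: polyruns_seq; first exact: scanR_spec.
apply: polyruns_seq; first exact: polyruns_mvR.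
apply: polyruns_seq; first exact: scanR_spec.
apply: polyruns_seq; first exact: polyruns_mvR.
apply: polyruns_seq; first exact: scanR_spec.
apply: polyruns_seq; first exact: wr.
rewrite catA -rev_cat -Z'E.
apply: polyruns_seq; first exact: toSep_spec.
apply: polyruns_seq; first exact: toSep_spec.
apply: polyruns_seq; first exact: toSep_spec.
by rewrite rev_rcons; apply: polyruns_act.
Qed.

(** Sending [Blank] to the empty word makes all images clean, as [opCopy_spec] demands for every
    symbol. *)
Definition letter (a : Sym) : seq Sym := if nb a then [:: a] else [::].

Lemma clean_letter a : clean (letter a).
Proof. by case: a. Qed.

Lemma flatten_letter x : clean x -> flatten (map letter x) = x.
Proof. by rewrite /letter; elim: x => //= a x IH /andP[-> /IH ->]. Qed.

Definition opOver := Seq opNew (opCopy letter).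

Lemma opOver_spec : exists c, forall s L x y,
  size x <= s -> size y <= s -> clean x -> clean y ->
  polyruns c s opOver (stk2 L x y) (stk3 L x y x).
Proof.
have [c copy] := opCopy_spec clean_letter.
eexists => s L x y xs ys cx cy.
apply: polyruns_seq; first exact: opNew_spec.
have := copy s L x y [::] xs ys isT cx cy isT; rewrite cat0s flatten_letter //; apply.
Qed.

Definition opMap h := Seq opNew (Seq opNew (Seq (opCopy h) opNip)).

Lemma opMap_spec h : (forall a, clean (h a)) -> exists c, forall s L x,
  size x <= s -> clean x ->
  polyruns c s (opMap h) (stk1 L x) (stk2 L x (flatten (map h x))).
Proof.
move=> ch; have [c copy] := opCopy_spec ch; have [c' nip] := opNip_spec.
have [k hk] := sym_fun_bounded h.
eexists => s L x xs cx; set s' := k.+1 * s.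
have ss' : s <= s' by rewrite /s' mulSn leq_addr.
apply: (@polyruns_scale k.+3 _ _ s'); last exact: mul_le_expn.
have xs' := leq_trans xs ss'.
apply: polyruns_seq; first exact: opNew_spec xs' cx.
apply: polyruns_seq; first exact: opNew_spec.
apply: polyruns_seq; first exact: copy.
apply: nip => //; last exact: clean_flatten_map.
apply: leq_trans (size_flatten_map_le _ hk) _.
by rewrite /s' mulSn (leq_trans _ (leq_addl _ _)) // leq_mul2l xs orbT.
Qed.

Definition opDup := opMap letter.

Lemma opDup_spec : exists c, forall s L x, size x <= s -> clean x ->
  polyruns c s opDup (stk1 L x) (stk2 L x x).
Proof.
have [c map] := opMap_spec clean_letter.
by exists c => s L x xs cx; have := map s L x xs cx; rewrite flatten_letter //; apply.
Qed.

Definition dblw (w : seq Sym) := flatten (map dbl w).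

Lemma clean_dblw w : clean (dblw w).
Proof. by apply: clean_flatten_map; case. Qed.

Lemma size_dblw w : size (dblw w) = 2 * size w.
Proof. by elim: w => //= a w IH; rewrite /dblw /= size_cat -/(dblw w) IH; case: a => /=; lia. Qed.

Lemma not_sep_dblw w : all not_sep (dblw w).
Proof. by elim: w => // a w IH; rewrite /dblw /= all_cat; apply/andP; split => //; case: a. Qed.

Definition opDbl := Seq (opMap dbl) opNip.

Lemma opDbl_spec : exists c, forall s L x, size x <= s -> clean x ->
  polyruns c s opDbl (stk1 L x) (stk1 L (dblw x)).
Proof.
have cd a : clean (dbl a) by case: a.
have [c map] := opMap_spec cd.
have [c' nip] := opNip_spec.
eexists => s L x xs cx; apply: polyruns_seq; first exact: map xs cx.
apply: (@polyruns_scale 4 _ _ (2 * s)); last exact: mul_le_expn.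
by apply: nip; rewrite ?clean_dblw ?size_dblw //; lia.
Qed.

(** The word is used as a queue: two code letters are taken off the front and the decoded letter is
    put at the back. Codes never start with [Sep], so the appended [Sep] marks the end of the
    undecoded part. *)
Definition opUndbl :=
  Seq (opApp Sep) (Seq
    (While not_sep
      (If (fun s => if s is One then true else false)
        (Seq opPop (Seq opPop (opApp One)))
        (Seq opPop (If (fun s => if s is One then true else false)
          (Seq opPop (opApp Sep)) (Seq opPop (opApp Zero))))))
    opPop).

Lemma opUndbl_spec : exists c, forall s L x, size x <= s -> clean x ->
  polyruns c s opUndbl (stk1 L (dblw x)) (stk1 L x).
Proof.
eexists => s L x xs cx; set s' := 4 * s.+2.
apply: (@polyruns_scale 4 _ _ s'); last by rewrite /s' !expnS expn0; nia.
apply: polyruns_seq.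
  by apply: opApp_spec; rewrite ?clean_dblw // size_dblw /s'; lia.
pose J (u v : seq Sym) : tape := stk1 L (dblw v ++ Sep :: u).
apply: (@polyruns_seq _ _ _ _ _ _ (J x [::])); last first.
  by apply: opPop_spec => //; rewrite /s'; lia.
rewrite -cats1; apply: (@polyruns_while _ _ _ J x 64) => [|u a v xE|//]; first by rewrite /s'; lia.
have [na cv cu] : [/\ nb a, clean v & clean u].
  by move: cx; rewrite xE clean_cat /= => /and3P[].
have us : (2 * size v + size u).+4 <= s'.
  by move: xs; rewrite xE size_cat /= /s'; lia.
have JE b : stk1 L (rcons (dblw v ++ Sep :: u) b) = stk1 L (dblw v ++ Sep :: rcons u b).
  by rewrite -!cats1 -catA.
have cl : clean (dblw v ++ Sep :: u).
  by rewrite clean_cat clean_dblw.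
have popC b : polyruns 22 s' opPop (stk1 L (b :: dblw v ++ Sep :: u))
                (stk1 L (dblw v ++ Sep :: u)).
  by apply: opPop_spec => //; rewrite size_cat size_dblw /=; lia.
have appC b : polyruns 14 s' (opApp b) (stk1 L (dblw v ++ Sep :: u))
                (stk1 L (dblw v ++ Sep :: rcons u b)).
  by rewrite -JE; apply: opApp_spec => //; rewrite size_cat size_dblw /=; lia.
have pop2 b b' : nb b' -> polyruns 22 s' opPop (stk1 L (b :: b' :: dblw v ++ Sep :: u))
                (stk1 L (b' :: dblw v ++ Sep :: u)).
  move=> nb'; apply: opPop_spec; first by rewrite /= size_cat size_dblw /=; lia.
  by rewrite /clean /= nb'.
rewrite /J; split; first by case: a {xE na}.
have -> : dblw (a :: v) ++ Sep :: u = dbl a ++ dblw v ++ Sep :: u by rewrite -catA.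
case: a na {xE} => //= _.
- apply: polyruns_ifF => //; apply: (@polyruns_seq 22 39); first exact: pop2.
  by apply: polyruns_ifF => //; apply: polyruns_seq (popC _) (appC _).
- apply: polyruns_ifT => //; apply: (@polyruns_exp 62) => //.
  apply: (@polyruns_seq 22 38); first exact: pop2.
  by apply: polyruns_seq (popC _) (appC _).
- apply: polyruns_ifF => //; apply: (@polyruns_seq 22 39); first exact: pop2.
  by apply: polyruns_ifT => //; apply: polyruns_seq (popC _) (appC _).
Qed.

Definition opFst := Seq opSplit (Seq opDrop opUndbl).

Lemma opFst_spec : exists c, forall s L x y, size (dblw x) + size y <= s ->
  clean x -> clean y -> polyruns c s opFst (stk1 L (dblw x ++ Sep :: y)) (stk1 L x).
Proof.
have [c drop] := opDrop_spec; have [c' undbl] := opUndbl_spec.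
eexists => s L x y xys cx cy.
apply: polyruns_seq; first by apply: opSplit_spec (not_sep_dblw _); lia.
apply: polyruns_seq; first by apply: drop; rewrite ?clean_dblw //; lia.
by apply: undbl => //; move: xys; rewrite size_dblw; lia.
Qed.

Definition opSnd := Seq opSplit opNip.

Lemma opSnd_spec : exists c, forall s L x y, size (dblw x) + size y <= s ->
  clean y -> polyruns c s opSnd (stk1 L (dblw x ++ Sep :: y)) (stk1 L y).
Proof.
have [c nip] := opNip_spec.
eexists => s L x y xys cy.
apply: polyruns_seq; first by apply: opSplit_spec (not_sep_dblw _); lia.
by apply: nip; rewrite ?clean_dblw //; lia.
Qed.

(** * Polynomial time functions on encoded data *)

Class Enc (T : Type) := { enc : T -> seq Sym; clean_enc : forall x, clean (enc x) }.

Arguments enc : simpl never.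

Lemma clean_enc_nat n : clean (enc_nat n).
Proof. by rewrite /clean all_map; apply/allP => -[]. Qed.

#[global] Instance Enc_nat : Enc nat := {| enc := enc_nat; clean_enc := clean_enc_nat |}.
#[global] Instance Enc_bool : Enc bool :=
  {| enc := fun b : bool => enc_nat b; clean_enc := fun b => clean_enc_nat b |}.
#[global] Instance Enc_unit : Enc unit := {| enc _ := [::]; clean_enc _ := isT |}.

(* With this encoding [a :: l] and [(a, l)] are the same word, and lists agree with [enc_list]. *)
Definition enc_pair (u v : seq Sym) := dblw u ++ Sep :: v.

Lemma clean_enc_pair u v : clean v -> clean (enc_pair u v).
Proof. by move=> cv; rewrite clean_cat clean_dblw. Qed.

#[global] Instance Enc_prod T U `{Enc T} `{Enc U} : Enc (T * U) :=
  {| enc p := enc_pair (enc p.1) (enc p.2);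
     clean_enc p := clean_enc_pair _ (clean_enc p.2) |}.

Lemma clean_enc_seq T `{Enc T} (l : seq T) :
  clean (foldr (fun a w => enc_pair (enc a) w) [::] l).
Proof. by elim: l => //= a l IH; apply: clean_enc_pair. Qed.

#[global] Instance Enc_seq T `{Enc T} : Enc (seq T) :=
  {| enc l := foldr (fun a w => enc_pair (enc a) w) [::] l; clean_enc := clean_enc_seq (T := T) |}.

Lemma size_enc_pair u v : size (enc_pair u v) = (2 * size u + size v).+1.
Proof. by rewrite size_cat size_dblw /= addnS. Qed.

Lemma size_encP T U `{Enc T} `{Enc U} (p : T * U) :
  size (enc p) = (2 * size (enc p.1) + size (enc p.2)).+1.
Proof. exact: size_enc_pair. Qed.

Lemma size_enc_cons T `{Enc T} a (l : seq T) :
  size (enc (a :: l)) = (2 * size (enc a) + size (enc l)).+1.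
Proof. exact: size_enc_pair. Qed.

Lemma size_enc_cat T `{Enc T} (l l' : seq T) :
  size (enc (l ++ l')) = size (enc l) + size (enc l').
Proof. by elim: l => // a l IH; rewrite cat_cons !size_enc_cons IH; lia. Qed.

Lemma size_le_enc T `{Enc T} (l : seq T) : size l <= size (enc l).
Proof. by elim: l => // a l IH; rewrite size_enc_cons /=; lia. Qed.

Lemma size_enc_seq_le T `{Enc T} k (l : seq T) :
  (forall a, List.In a l -> size (enc a) <= k) -> size (enc l) <= size l * (2 * k).+1.
Proof.
elim: l => // a l IH le; rewrite size_enc_cons /= (mulSn (size l)).
have := le a (or_introl erefl); have := IH (fun b h => le b (or_intror h)).
by move: (size l * _) => m; lia.
Qed.

(* [x] ranges over an arbitrary index type, so that a program may be specified only on part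
   of the words. *)
Definition fpW (X : Type) (pre post : X -> seq Sym) :=
  exists p c, forall L x,
    polyruns c (size (pre x)) p (stk1 L (pre x)) (stk1 L (post x)).

Definition fp A B `{Enc A} `{Enc B} (f : A -> B) := fpW enc (fun a => enc (f a)).

(** Each step moves the last nonblank cell by at most one position relative to the head. Hence a
    polynomial running time by itself bounds the size of the output. *)
Lemma exec_support p t n t' k : exec p t n t' ->
  (forall i, k < i -> t.2 i = Blank) -> forall i, k + n < i -> t'.2 i = Blank.
Proof.
move=> e; elim: e k => {p t n t'}.
- move=> f m [L R] k /= Rk [|[|i]] //; rewrite addn1 !ltnS // => ki.
  by case: m; rewrite /= /stl ?Rk //; lia.
- move=> p q t n t1 n' t2 _ IH1 _ IH2 k tk i ki.
  by apply: (IH2 (k + n)); [exact: IH1 | lia].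
- by move=> b p q t n t' _ _ IH k tk i ki; apply: (IH k) => //; lia.
- by move=> b p q t n t' _ _ IH k tk i ki; apply: (IH k) => //; lia.
- by move=> b p t _ k tk i; rewrite addn0; apply: tk.
- move=> b p t n t1 n' t2 _ _ IH1 _ IH2 k tk i ki.
  by apply: (IH2 (k + n)); [exact: IH1 | lia].
Qed.

Lemma prep_support w i : size w <= i -> (w +++ blanks) i = Blank.
Proof. by elim: w i => // a w IH [|i] //=; apply: IH. Qed.

Lemma prep_clean w i : clean w -> i < size w -> nb ((w +++ blanks) i).
Proof. by elim: w i => // a w IH [|i] /= /andP[] // na cw; apply: IH. Qed.

Lemma polyruns_output_size c s p L x L' y :
  polyruns c s p (stk1 L x) (stk1 L' y) -> clean y -> size y <= (size x + s.+2 ^ c).+1.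
Proof.
case=> m mle e cy; apply: leq_trans (_ : (size x + m).+1 <= _); last by lia.
rewrite leqNgt; apply/negP => lt.
have h := exec_support e (fun i lti => prep_support (ltnW lti)) (ltnSn (size x + m)).
by have := prep_clean cy lt; rewrite [(_ +++ _) _]h.
Qed.

Lemma fpW_size X (pre post : X -> seq Sym) : fpW pre post -> (forall x, clean (post x)) ->
  exists c, forall x, size (post x) <= (size (pre x)).+2 ^ c.
Proof.
case=> p [c H] cl; exists c.+2 => x.
apply: leq_trans (polyruns_output_size (H [::] x) (cl x)) _.
rewrite !expnS; have : 0 < (size (pre x)).+2 ^ c by rewrite expn_gt0.
by nia.
Qed.

Section Words.
Variables (X : Type).
Implicit Types (pre post mid : X -> seq Sym).

Lemma fpW_comp pre mid post : (forall x, clean (mid x)) ->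
  fpW pre mid -> fpW mid post -> fpW pre post.
Proof.
move=> cm f; have [d sz] := fpW_size f cm.
case: f => p [c H] [q [c' H']]; exists (Seq p q); eexists => L x.
apply: polyruns_seq; first exact: H.
apply: polyruns_scale (H' L x) (sz x).
Qed.

Lemma fpW_id pre : fpW pre pre.
Proof.
exists (Act id Stay), 0 => L x; have := polyruns_act id Stay (size (pre x)) (stk1 L (pre x)).
by rewrite act_stay.
Qed.

Lemma fpW_ext pre pre' post post' : pre =1 pre' -> post =1 post' ->
  fpW pre post -> fpW pre' post'.
Proof. by move=> e e' [p [c H]]; exists p, c => L x; rewrite -e -e'. Qed.

(** A program consumes its argument, so the input stays below on the stack: it is duplicated for
    [w1], copied up again for [w2], and removed once the pair is assembled on top. *)
Lemma fpW_pair pre w1 w2 :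
  (forall x, clean (pre x)) -> (forall x, clean (w1 x)) -> (forall x, clean (w2 x)) ->
  fpW pre w1 -> fpW pre w2 -> fpW pre (fun x => enc_pair (w1 x) (w2 x)).
Proof.
move=> cp c1 c2 f1 f2.
have [d1 sz1] := fpW_size f1 c1; have [d2 sz2] := fpW_size f2 c2.
case: f1 f2 => p1 [k1 H1] [p2 [k2 H2]].
have [kd dup] := opDup_spec; have [ko over] := opOver_spec; have [kn nip] := opNip_spec.
have [kD dblP] := opDbl_spec.
exists (Seq opDup (Seq p1 (Seq opDbl (Seq (opApp Sep) (Seq opOver (Seq p2 (Seq opJoin opNip))))))).
eexists => L x.
set n := size (pre x).
pose s := 2 * n.+2 ^ d1 + n.+2 ^ d2 + n + 1.
have ss : s <= n.+2 ^ (d1 + d2 + 4).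
  rewrite !expnD /s; have : 0 < n.+2 ^ d1 by rewrite expn_gt0.
  have : 0 < n.+2 ^ d2 by rewrite expn_gt0.
  by move: (n.+2 ^ d1) (n.+2 ^ d2) => A B; rewrite !expnS expn0; nia.
have := sz1 x; have := sz2 x; rewrite -/n => s2 s1.
apply: polyruns_seq; first exact: dup.
apply: polyruns_seq; first exact: H1.
have w1s : size (w1 x) <= s by rewrite /s; lia.
apply: (polyruns_scale _ ss).
apply: polyruns_seq; first exact: dblP w1s _.
have dw1s : size (dblw (w1 x)) <= s by rewrite size_dblw /s; lia.
apply: polyruns_seq; first exact: opApp_spec (clean_dblw _).
have rs : size (rcons (dblw (w1 x)) Sep) <= s by rewrite size_rcons size_dblw /s; lia.
have cr : clean (rcons (dblw (w1 x)) Sep) by rewrite -cats1 clean_cat clean_dblw.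
apply: polyruns_seq; first by apply: over => //; rewrite /s -/n; lia.
apply: polyruns_seq; first by apply: polyruns_size (H2 _ _) _; rewrite /s -/n; lia.
rewrite -/(stk2 (rev (pre x) ++ Blank :: L) (rcons (dblw (w1 x)) Sep) (w2 x)).
apply: polyruns_seq; first by apply: opJoin_spec => //; rewrite size_rcons size_dblw /s; lia.
rewrite cat_rcons; apply: nip => //; last exact: clean_enc_pair.
  by rewrite /s -/n; lia.
by rewrite size_enc_pair /s; lia.
Qed.

Lemma fpW_fst (w1 w2 : X -> seq Sym) : (forall x, clean (w1 x)) -> (forall x, clean (w2 x)) ->
  fpW (fun x => enc_pair (w1 x) (w2 x)) w1.
Proof.
have [c H] := opFst_spec => c1 c2; exists opFst, c.+1 => L x.
apply: polyruns_exp (leqnSn c); apply: H => //.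
by rewrite size_cat /= leq_add2l.
Qed.

Lemma fpW_snd (w1 w2 : X -> seq Sym) : (forall x, clean (w2 x)) ->
  fpW (fun x => enc_pair (w1 x) (w2 x)) w2.
Proof.
have [c H] := opSnd_spec => c2; exists opSnd, c => L x; apply: H => //.
by rewrite size_cat /= leq_add2l.
Qed.

End Words.

Lemma fpW_sub X Y (f : Y -> X) (pre post : X -> seq Sym) :
  fpW pre post -> fpW (pre \o f) (post \o f).
Proof. by case=> p [c H]; exists p, c => L y; apply: H. Qed.

(** [false] is the empty word and [true] is not, so one look at the first cell decides. Each branch
    is specified only on the subtype where it is taken. *)
Lemma fpW_if X (b : X -> bool) (pre post : X -> seq Sym) : (forall x, clean (pre x)) ->
  fpW pre (fun x => enc (b x)) ->
  fpW (fun x : {x | b x} => pre (val x)) (fun x => post (val x)) ->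
  fpW (fun x : {x | ~~ b x} => pre (val x)) (fun x => post (val x)) ->
  fpW pre post.
Proof.
move=> cp [pb [cb Hb]] [p [c H]] [q [c' H']].
have [kd dup] := opDup_spec; have [kD drop] := opDrop_spec.
exists (Seq opDup (Seq pb (If nb (Seq opDrop p) (Seq opDrop q)))); eexists => L x.
apply: polyruns_seq; first exact: dup.
apply: polyruns_seq; first exact: Hb.
have hd (y : bool) : size (enc y) <= (size (pre x)).+2 ^ 1 by case: y; rewrite expn1.
case: (boolP (b x)) => bx.
  apply: polyruns_ifT; first by [].
  apply: (@polyruns_exp ((1.+2 * kD + c).+2) (1.+2 * kD + c + c').+2); last by lia.
  apply: polyruns_seq; last exact: (H L (exist _ x bx)).
  apply: polyruns_scale (_ : _ <= (size (pre x)).+2 ^ 1).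
    by apply: (drop (size (pre x)).+1) => //=; exact: ltnW.
  by rewrite expn1.
apply: polyruns_ifF; first by [].
apply: (@polyruns_exp ((1.+2 * kD + c').+2)); last by lia.
apply: polyruns_seq; last exact: (H' L (exist _ x bx)).
apply: polyruns_scale (_ : _ <= (size (pre x)).+2 ^ 1).
  by apply: (drop (size (pre x)).+1) => //=; exact: ltnW.
by rewrite expn1.
Qed.

Lemma prep_head w : (w +++ blanks) 0 = head Blank w.
Proof. by case: w. Qed.

Lemma fpW_ifhead X (b : Sym -> bool) (pre post : X -> seq Sym) :
  fpW (fun x : {x | b (head Blank (pre x))} => pre (val x)) (fun x => post (val x)) ->
  fpW (fun x : {x | ~~ b (head Blank (pre x))} => pre (val x)) (fun x => post (val x)) ->
  fpW pre post.
Proof.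
move=> [p [c H]] [q [c' H']]; exists (If b p q), (c + c').+1 => L x.
case: (boolP (b (head Blank (pre x)))) => bx.
  apply: polyruns_ifT; first by rewrite /= prep_head.
  by apply: polyruns_exp (H L (exist _ x bx)) _; exact: leq_addr.
apply: polyruns_ifF; first by rewrite /= prep_head.
by apply: polyruns_exp (H' L (exist _ x bx)) _; exact: leq_addl.
Qed.

Lemma opApps_spec w : clean w -> exists p c, forall s L x, size x <= s -> clean x ->
  polyruns c s p (stk1 L x) (stk1 L (x ++ w)).
Proof.
elim: w => [|a w IH] cw.
  exists (Act id Stay), 0 => s L x _ _; rewrite cats0.
  by have := polyruns_act id Stay s (stk1 L x); rewrite act_stay.
case/andP: cw => na /IH[p [c H]]; exists (Seq (opApp a) p); eexists => s L x xs cx.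
apply: polyruns_seq; first exact: opApp_spec.
rewrite -cat_rcons; apply: (@polyruns_scale 1 _ _ s.+2); last by rewrite expn1.
by apply: H; rewrite ?size_rcons ?ltnS ?(leqW xs) // -cats1 clean_cat cx /= na.
Qed.

Lemma fpW_const X (pre : X -> seq Sym) w : (forall x, clean (pre x)) -> clean w ->
  fpW pre (fun _ => w).
Proof.
move=> cp cw; have [k clear] := opClear_spec; have [p [c H]] := opApps_spec cw.
exists (Seq opClear p); eexists => L x.
apply: polyruns_seq; first exact: clear.
exact: (H _ _ [::]).
Qed.

Lemma fpW_prepend X (pre : X -> seq Sym) a : (forall x, clean (pre x)) -> nb a ->
  fpW pre (fun x => a :: pre x).
Proof.
move=> cp na.
have [ko over] := opOver_spec; have [kn nip] := opNip_spec.
exists (Seq opNew (Seq (opApp a) (Seq opOver (Seq opJoin opNip)))); eexists => L x.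
set n := size _; have nn : n.+1 <= n.+2 ^ 1 by rewrite expn1.
have ca : clean [:: a] by rewrite /= na.
apply: polyruns_seq; first exact: opNew_spec.
apply: (polyruns_scale _ nn).
apply: polyruns_seq; first exact: opApp_spec.
apply: polyruns_seq; first by apply: over => //; apply: leqW.
apply: polyruns_seq; first by apply: opJoin_spec.
by apply: nip; rewrite /= ?na // cp.
Qed.

Lemma fpW_behead X (pre : X -> seq Sym) : (forall x, clean (pre x)) ->
  fpW pre (fun x => behead (pre x)).
Proof.
move=> cp; apply: (@fpW_ifhead _ nb).
  exists opPop, 22 => L [x bx] /=; have := cp x; case: (pre x) bx => [|a w] //= _ /andP[_ cw].
  by apply: opPop_spec.
apply: fpW_ext (fpW_id (fun x : {x | ~~ nb (head Blank (pre x))} => pre (val x))) => // -[x bx] /=.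
by have := cp x; case: (pre x) bx => [|a w] //= /negPf->.
Qed.

Lemma fp_id A `{Enc A} : fp (fun x : A => x).
Proof. exact: fpW_id. Qed.

Section Typed.
Context (A B C D : Type) `{Enc A} `{Enc B} `{Enc C} `{Enc D}.

Lemma fp_comp (g : B -> C) (f : A -> B) : fp g -> fp f -> fp (fun x => g (f x)).
Proof.
move=> Hg Hf; apply: fpW_comp Hf (fpW_sub f Hg) => x; exact: clean_enc.
Qed.

Lemma fp_cast (f : A -> B) : (forall x, enc (f x) = enc x) -> fp f.
Proof. by move=> e; apply: fpW_ext (fpW_id enc). Qed.

Lemma fp_ext (f g : A -> B) : f =1 g -> fp f -> fp g.
Proof. by move=> e; apply: fpW_ext => // x; rewrite e. Qed.

Lemma fp_const (b : B) : fp (fun _ : A => b).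
Proof. by apply: fpW_const => *; apply: clean_enc. Qed.

Lemma fp_pair (f : A -> B) (g : A -> C) : fp f -> fp g -> fp (fun x => (f x, g x)).
Proof. by apply: fpW_pair => x; apply: clean_enc. Qed.

Lemma fp_1 (f : A -> B * C) : fp f -> fp (fun x => (f x).1).
Proof.
move=> Hf; apply: fpW_comp Hf _; first by move=> x; apply: clean_enc.
by apply: (@fpW_fst _ (fun x => enc (f x).1) (fun x => enc (f x).2)) => x; apply: clean_enc.
Qed.

Lemma fp_2 (f : A -> B * C) : fp f -> fp (fun x => (f x).2).
Proof.
move=> Hf; apply: fpW_comp Hf _; first by move=> x; apply: clean_enc.
by apply: (@fpW_snd _ (fun x => enc (f x).1) (fun x => enc (f x).2)) => x; apply: clean_enc.
Qed.

Lemma fp_if (b : A -> bool) (f g : A -> B) :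
  fp b -> fp f -> fp g -> fp (fun x => if b x then f x else g x).
Proof.
move=> Hb Hf Hg; apply: (@fpW_if _ b) => //; first by move=> x; apply: clean_enc.
  by apply: fpW_ext (fpW_sub (val : {x | b x} -> A) Hf) => // -[x bx] /=; rewrite bx.
by apply: fpW_ext (fpW_sub (val : {x | ~~ b x} -> A) Hg) => // -[x bx] /=; rewrite (negPf bx).
Qed.

Lemma head_enc_cons (a : A) l : nb (head Blank (enc (a :: l))).
Proof. by rewrite /enc /= /enc_pair; case: (enc a) => [|[]]. Qed.

(** A pair starts with [Sep] exactly when its first component is the empty word. Loops keep their
    remaining work in that component and test this one symbol. *)
Lemma not_sep_enc_cons (a : A) (l : seq A) (b : B) : not_sep (head Blank (enc (a :: l, b))).
Proof. by rewrite {1}/enc /= /enc_pair {1}/enc /= /enc_pair; case: (enc a) => [|[]]. Qed.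

Lemma fp_nilp : fp (@nilp A).
Proof.
apply: (@fpW_ifhead _ nb).
  apply: fpW_ext (fpW_const (w := [::]) _ _) => //; last by move=> x; apply: clean_enc.
  by move=> [[|a l] bx].
apply: fpW_ext (fpW_const (w := [:: One]) _ _) => //; last by move=> x; apply: clean_enc.
by move=> [[|a l] bx] //=; have := bx; rewrite head_enc_cons.
Qed.

End Typed.

Lemma fp_cons_pair A `{Enc A} : fp (fun p : A * seq A => p.1 :: p.2).
Proof. by apply: fp_cast => -[a l]. Qed.

Lemma fp_size A B `{Enc A} `{Enc B} (f : A -> B) : fp f ->
  exists c, forall x, size (enc (f x)) <= (size (enc x)).+2 ^ c.
Proof. by move=> Hf; apply: fpW_size Hf _ => x; apply: clean_enc. Qed.

Definition pbound A `{Enc A} (m : A -> nat) :=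
  exists c, forall x, m x <= (size (enc x)).+2 ^ c.

Section PBound.
Context (A : Type) `{Enc A}.
Implicit Types m : A -> nat.

Lemma pbound_le m m' : (forall x, m x <= m' x) -> pbound m' -> pbound m.
Proof. by move=> le [c b]; exists c => x; apply: leq_trans (le x) (b x). Qed.

Lemma pbound_const k : pbound (fun _ : A => k).
Proof.
exists k => x; apply: leq_trans (ltnW (ltn_expl k (ltnSn 1))) _.
by case: k => // k; rewrite leq_exp2r.
Qed.

Lemma pbound_add m1 m2 : pbound m1 -> pbound m2 -> pbound (fun x => m1 x + m2 x).
Proof.
move=> [c1 b1] [c2 b2]; exists (c1 + c2).+1 => x.
apply: leq_trans (leq_add (b1 x) (b2 x)) _; rewrite expnS expnD.
move: (size (enc x)) => n.
have : 0 < n.+2 ^ c1 by rewrite expn_gt0.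
have : 0 < n.+2 ^ c2 by rewrite expn_gt0.
by nia.
Qed.

Lemma pbound_mul m1 m2 : pbound m1 -> pbound m2 -> pbound (fun x => m1 x * m2 x).
Proof.
by move=> [c1 b1] [c2 b2]; exists (c1 + c2) => x; rewrite expnD leq_mul.
Qed.

Lemma pbound_S m : pbound m -> pbound (fun x => (m x).+1).
Proof.
by move=> b; apply: pbound_le (pbound_add b (pbound_const 1)) => x; rewrite addn1.
Qed.

Lemma pbound_enc B `{Enc B} (f : A -> B) : fp f -> pbound (fun x => size (enc (f x))).
Proof. exact: fp_size. Qed.

Lemma pbound_size B `{Enc B} (f : A -> seq B) : fp f -> pbound (fun x => size (f x)).
Proof. by move=> /pbound_enc; apply: pbound_le => x; apply: size_le_enc. Qed.

End PBound.

Section Foldl.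
Context (X A S : Type) `{Enc X} `{Enc A} `{Enc S}.
Variables (step : X * (S * A) -> S) (init : X -> S) (l : X -> seq A).

Definition fold_upto x (l1 : seq A) : S := foldl (fun s a => step (x, (s, a))) (init x) l1.

Definition fold_tape L x (u v : seq A) : tape := stk1 L (enc (v, (x, fold_upto x u))).

(** The tape holds the rest of the list, the parameter and the accumulator. The last hypothesis is
    essential: a polynomial step might square the size of the accumulator in every round. It is
    asked only for prefixes of the actual list. *)
Lemma fp_foldl : fp step -> fp init -> fp l ->
  (exists c, forall x l1 l2, l x = l1 ++ l2 ->
     size (enc (fold_upto x l1)) <= (size (enc x)).+2 ^ c) ->
  fp (fun x => foldl (fun s a => step (x, (s, a))) (init x) (l x)).
Proof.
move=> Hstep Hinit Hl [cb bd].
pose body (p : (A * seq A) * (X * S)) :=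
  (p.1.2, (p.2.1, step (p.2.1, (p.2.2, p.1.1)))).
have [pb [kb Hb]] : fp body.
  have f0 : fp (fun p : (A * seq A) * (X * S) => p) by exact: fp_id.
  have f1 := fp_1 f0; have f2 := fp_2 f0.
  by apply: fp_pair (fp_2 f1) (fp_pair (fp_1 f2) (fp_comp Hstep _));
    apply: fp_pair (fp_1 f2) (fp_pair (fp_2 f2) (fp_1 f1)).
pose start x := (l x, (x, init x)).
have Hstart : fp start by apply: fp_pair Hl (fp_pair (fp_cast (fun _ => erefl)) Hinit).
pose stop x := ([::] : seq A, (x, fold_upto x (l x))).
have Hstop : fpW (fun x => enc (stop x)) (fun x => enc (fold_upto x (l x))).
  have f0 : @fp (seq A * (X * S)) _ _ _ (fun p : seq A * (X * S) => p) by exact: fp_id.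
  exact: (fpW_sub stop (fp_2 (fp_2 f0))).
apply: (fpW_comp (mid := fun x => enc (start x))) Hstart _; first by move=> x; apply: clean_enc.
apply: (fpW_comp (mid := fun x => enc (stop x))) _ Hstop; first by move=> x; apply: clean_enc.
exists (While not_sep pb); eexists => L x.
set n := size (enc (start x)).
have xn : size (enc x) <= n.
  by rewrite /n /start !size_encP /= -[X in _ <= X]addn1; lia.
have ln : size (enc (l x)) <= n by rewrite /n /start !size_encP /=; lia.
pose J := fold_tape L x.
pose s := n + n.+2 ^ cb + 4 * n + 4.
have ss : s <= n.+2 ^ (cb + 4).
  rewrite /s expnD; have : 0 < n.+2 ^ cb by rewrite expn_gt0.
  by move: (n.+2 ^ cb) => K; rewrite !expnS expn0; nia.
apply: (polyruns_scale _ ss).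
refine (@polyruns_while _ _ _ J (l x) kb s _ _ _) => [|u a v xE|]; last by [].
  by apply: leq_trans (size_le_enc _) _; apply: leq_trans ln _; rewrite /s; lia.
split; first by rewrite /J /= prep_head not_sep_enc_cons.
have -> : J (rcons u a) v = stk1 L (enc (body ((a, v), (x, fold_upto x u)))).
  by rewrite /J /fold_tape /body /fold_upto foldl_rcons.
apply: polyruns_size (Hb L ((a, v), (x, fold_upto x u))) _.
have fs : size (enc (fold_upto x u)) <= n.+2 ^ cb.
  apply: leq_trans (bd _ _ _ xE) _; case: (cb) => // k; rewrite leq_exp2r //.
have vs : size (enc (a :: v)) <= n.
  by apply: leq_trans ln; rewrite xE size_enc_cat leq_addl.
by move: vs; rewrite size_enc_cons !size_encP /= /s; lia.
Qed.

End Foldl.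

(** * Arithmetic *)

Lemma fp_foldl_bound X A S `{Enc X} `{Enc A} `{Enc S}
    (step : X -> S -> A -> S) (init : X -> S) (l : X -> seq A) (m : X -> nat) :
  fp (fun p : X * (S * A) => step p.1 p.2.1 p.2.2) -> fp init -> fp l -> pbound m ->
  (forall x l1 l2, l x = l1 ++ l2 -> size (enc (foldl (step x) (init x) l1)) <= m x) ->
  fp (fun x => foldl (step x) (init x) (l x)).
Proof.
move=> Hs Hi Hl [c mb] bd.
apply: (fp_foldl Hs Hi Hl); exists c => x l1 l2 e.
exact: leq_trans (bd x l1 l2 e) (mb x).
Qed.

Lemma fp_cons X A `{Enc X} `{Enc A} (f : X -> A) (g : X -> seq A) :
  fp f -> fp g -> fp (fun x => f x :: g x).
Proof.
move=> Hf Hg.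
exact: (fp_comp (f := fun x => (f x, g x)) (fp_cons_pair (A := A)) (fp_pair Hf Hg)).
Qed.

Section Bits.

Lemma half_le n : n.+1./2 <= n.
Proof. by have := odd_double_half n.+1; move: (_./2) => h; rewrite -muln2; case: odd; lia. Qed.

Lemma bits_aux_fuel f g n : n <= f -> n <= g -> bits_aux f n = bits_aux g n.
Proof.
elim: f g n => [|f IH] [|g] [|n] //= nf ng; rewrite (IH g) //.
  exact: leq_trans (half_le n) nf.
exact: leq_trans (half_le n) ng.
Qed.

Lemma bitsE n : 0 < n -> bits n = odd n :: bits n./2.
Proof.
case: n => // n _; rewrite /bits /=; congr cons; apply: bits_aux_fuel => //.
exact: half_le.
Qed.

Lemma enc_natE n : 0 < n -> enc n = (if odd n then One else Zero) :: enc n./2.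
Proof. by move=> n0; rewrite /enc /= /enc_nat bitsE. Qed.

Lemma enc_bit_double (b : bool) n : 0 < b + n -> enc (b + n.*2) = (if b then One else Zero) :: enc n.
Proof.
move=> n0; rewrite enc_natE; last by case: b n0 => //=; rewrite -!muln2; lia.
by rewrite oddD odd_double addbF oddb half_bit_double.
Qed.

Lemma size_enc_nat n k : (size (enc n) <= k) = (n < 2 ^ k).
Proof.
elim: k n => [|k IH] n; first by case: n => [|n] //; rewrite enc_natE.
case: n => [|n]; first by rewrite expn_gt0.
rewrite enc_natE // ltnS IH expnS mul2n.
by have := odd_double_half n.+1; move: n.+1./2 (odd n.+1) (2 ^ k) => h [] K; rewrite -!muln2; lia.
Qed.

Lemma ltn_size_enc (n : nat) : n < 2 ^ size (enc n).
Proof. by rewrite -size_enc_nat. Qed.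

Lemma size_enc_nat_le (n : nat) : size (enc n) <= n.
Proof. by rewrite size_enc_nat; exact: ltn_expl. Qed.

Lemma head_enc_nat n : head Blank (enc n) =
  if n == 0 then Blank else if odd n then One else Zero.
Proof. by case: n => // n; rewrite enc_natE. Qed.

Lemma fp_eq0_ : fp (fun n : nat => n == 0).
Proof.
apply: (@fpW_ifhead _ nb).
  apply: fpW_ext (fpW_const (w := [::]) _ _) => //; last by move=> x; apply: clean_enc.
  by move=> [n bn]; move: bn; rewrite /= head_enc_nat; case: eqP.
apply: fpW_ext (fpW_const (w := [:: One]) _ _) => //; last by move=> x; apply: clean_enc.
by move=> [n bn]; move: bn; rewrite /= head_enc_nat; case: eqP => //; case: odd.
Qed.

Lemma fp_odd_ : fp odd.
Proof.
apply: (@fpW_ifhead _ (fun s => if s is One then true else false)).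
  apply: fpW_ext (fpW_const (w := [:: One]) _ _) => //; last by move=> x; apply: clean_enc.
  by move=> [n bn]; move: bn; rewrite /= head_enc_nat; case: eqP => //; case: odd.
apply: fpW_ext (fpW_const (w := [::]) _ _) => //; last by move=> x; apply: clean_enc.
by move=> [n bn]; move: bn; rewrite /= head_enc_nat; case: eqP => [->|] //; case: odd.
Qed.

Lemma fp_half_ : fp half.
Proof.
apply: fpW_ext (fpW_behead _) => //; last by move=> x; apply: clean_enc.
by case=> // n; rewrite enc_natE.
Qed.

Lemma fp_bit_double_ : fp (fun p : bool * nat => p.1 + p.2.*2).
Proof.
(* Zero is the empty word; a digit [Zero] put in front of it would not be canonical, so this case is
   separate. *)
apply: (@fp_ext _ _ _ _ (fun p : bool * nat =>
    if p.1 then p.2.*2.+1 else if p.2 == 0 then 0 else p.2.*2)).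
  by case=> [[] [|n]].
have i : fp (fun p : bool * nat => p) by exact: fp_id.
have i2 := fp_2 i.
apply: fp_if (fp_1 i) (fp_comp (g := fun n => n.*2.+1) _ i2) _.
  apply: fpW_ext (fpW_prepend (a := One) _ _) => //; last by move=> n; apply: clean_enc.
  by move=> n /=; rewrite -[_.+1]/(true + _) enc_bit_double.
pose f (n : nat) := if n == 0 then 0 else n.*2.
apply: (fp_comp (g := f) _ i2); apply: (@fpW_if _ (fun n : nat => n == 0)).
- by move=> n; apply: clean_enc.
- exact: fp_eq0_.
- apply: fpW_ext (fpW_const (w := [::]) _ _) => //; last by move=> n; apply: clean_enc.
  by move=> [n /= /eqP->].
apply: fpW_ext (fpW_prepend (a := Zero) _ _) => //; last by move=> n; apply: clean_enc.
by move=> [n /= n0]; rewrite /f (negPf n0) -[_.*2]/(false + _) enc_bit_double // lt0n.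
Qed.

(** As [false] is the empty word, the digit list arises from the number by a letter-to-word map,
    which [opMap] performs. *)
Lemma enc_bits n : enc (bits n) =
  flatten (map (fun s => if s is One then [:: One; One; Sep] else [:: Sep]) (enc n)).
Proof. by rewrite /enc /= /enc_nat; elim: (bits n) => // b l /= ->; case: b. Qed.

Lemma fp_bits_ : fp bits.
Proof.
have [|c map] := @opMap_spec (fun s => if s is One then [:: One; One; Sep] else [:: Sep]).
  by case.
have [c' nip] := opNip_spec.
exists (Seq (opMap (fun s => if s is One then [:: One; One; Sep] else [:: Sep])) opNip).
eexists => L n; rewrite enc_bits; set h := fun _ => _.
have hs a : size (h a) <= 3 by case: a.
apply: polyruns_seq; first exact: map (leqnn _) (clean_enc _).
apply: (@polyruns_scale 5 _ _ (3 * size (enc n))); last exact: mul_le_expn.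
apply: nip => //; [by lia | exact: size_flatten_map_le hs | exact: clean_enc |].
by apply: clean_flatten_map; case.
Qed.

End Bits.

Definition msb_nat (l : seq bool) : nat := foldl (fun n (b : bool) => b + n.*2) 0 l.

Lemma msb_nat_foldl l n : foldl (fun n (b : bool) => b + n.*2) n l = n * 2 ^ size l + msb_nat l.
Proof.
rewrite /msb_nat; elim/last_ind: l => [|l b IH]; first by rewrite muln1 addn0.
by rewrite !foldl_rcons IH size_rcons expnS; move: (msb_nat l) (2 ^ _) => m K; rewrite -!muln2; lia.
Qed.

Lemma msb_nat_cons b l : msb_nat (b :: l) = b * 2 ^ size l + msb_nat l.
Proof. by rewrite /msb_nat /= msb_nat_foldl /msb_nat addn0. Qed.

Lemma msb_nat_ub l : msb_nat l < 2 ^ size l.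
Proof.
elim: l => // b l IH; rewrite msb_nat_cons /= expnS; case: b; lia.
Qed.

Lemma msb_nat_bits n : msb_nat (rev (bits n)) = n.
Proof.
elim/ltn_ind: n => -[|n] IH //; rewrite bitsE // rev_cons /msb_nat foldl_rcons.
by rewrite -/(msb_nat _) IH ?odd_double_half // ltnS half_le.
Qed.

(** Hooks of [fp_step], extended by [::=] whenever further operations have been shown polynomial. *)
Ltac fp_ops1 := fail.
Ltac fp_ops2 := fail.
Ltac fp_ops3 := fail.

Ltac fp_app :=
  match goal with
  | Hf : fp ?f |- fp (fun x => ?f (@?g x)) => apply: (fp_comp Hf)
  end.

Ltac fp_step :=
  cbv beta;
  lazymatch goal with
  | |- fp (fun x => x) => apply: fp_id
  | |- fp (fun _ => ?c) => apply: fp_const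
  | |- fp fst => exact: (fp_1 fp_id)
  | |- fp snd => exact: (fp_2 fp_id)
  | |- fp (fun x => fst (@?p x)) => apply: fp_1
  | |- fp (fun x => snd (@?p x)) => apply: fp_2
  | |- fp (fun x => pair (@?p x) (@?q x)) => apply: fp_pair
  | |- fp (fun x => cons (@?p x) (@?q x)) => apply: fp_cons
  | _ => first [fp_ops1 | fp_ops2 | fp_ops3 | fp_app | apply: fp_if]
  end.
Ltac fp_go := repeat first [assumption | fp_step].

Section Applicative.
Context (X : Type) `{Enc X}.
Lemma fp_comp2 A B C `{Enc A} `{Enc B} `{Enc C} (op : A -> B -> C) (f : X -> A) (g : X -> B) :
  fp (fun p : A * B => op p.1 p.2) -> fp f -> fp g -> fp (fun x => op (f x) (g x)).
Proof. by move=> Ho Hf Hg; exact: (fp_comp Ho (fp_pair Hf Hg)). Qed.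

Lemma fp_odd (f : X -> nat) : fp f -> fp (fun x => odd (f x)).
Proof. by move=> Hf; exact: (fp_comp fp_odd_ Hf). Qed.
Lemma fp_half (f : X -> nat) : fp f -> fp (fun x => (f x)./2).
Proof. by move=> Hf; exact: (fp_comp fp_half_ Hf). Qed.
Lemma fp_bits (f : X -> nat) : fp f -> fp (fun x => bits (f x)).
Proof. by move=> Hf; exact: (fp_comp fp_bits_ Hf). Qed.
Lemma fp_bit_double (b : X -> bool) (f : X -> nat) : fp b -> fp f -> fp (fun x => b x + (f x).*2).
Proof. by move=> Hb Hf; exact: (fp_comp2 (op := fun (b : bool) n => b + n.*2) fp_bit_double_ Hb Hf). Qed.
End Applicative.

Lemma pbound_exp A `{Enc A} (m : A -> nat) k : pbound m -> pbound (fun x => m x ^ k).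
Proof.
move=> [c b]; exists (c * k) => x; rewrite expnM.
by case: k => // k; rewrite leq_exp2r.
Qed.

Lemma foldl_inv S A (I : nat -> S -> Prop) (step : S -> A -> S) s l :
  (forall k s a, I k s -> I k.+1 (step s a)) -> I 0 s -> I (size l) (foldl step s l).
Proof.
move=> st I0; elim/last_ind: l => // l a IH.
by rewrite foldl_rcons size_rcons; apply: st.
Qed.

Lemma size_enc_rev A `{Enc A} (l : seq A) : size (enc (rev l)) = size (enc l).
Proof.
have e0 : size (enc ([::] : seq A)) = 0 by [].
by elim: l => // a l IH; rewrite rev_cons -cats1 size_enc_cat IH !size_enc_cons e0; lia.
Qed.

Lemma size_enc_cat_le A `{Enc A} (l l1 l2 : seq A) : l = l1 ++ l2 ->
  size (enc l1) <= size (enc l) /\ size (enc l2) <= size (enc l).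
Proof. by move=> ->; rewrite size_enc_cat leq_addr leq_addl. Qed.

Lemma size_In_enc A `{Enc A} (a : A) (l : seq A) : List.In a l -> size (enc a) <= size (enc l).
Proof. by elim: l => // b l IH [->|/IH h]; rewrite size_enc_cons; lia. Qed.

Lemma foldl_consE A (l l' : seq A) : foldl (fun s a => a :: s) l' l = rev l ++ l'.
Proof. by elim: l l' => // a l IH l' /=; rewrite IH rev_cons cat_rcons. Qed.

Section Lists.
Context (X A : Type) `{Enc X} `{Enc A}.

Lemma fp_rev (l : X -> seq A) : fp l -> fp (fun x => rev (l x)).
Proof.
move=> Hl.
apply: (@fp_ext _ _ _ _ (fun x => foldl (fun s a => a :: s) [::] (l x))).
  by move=> x; rewrite foldl_consE cats0.
apply: (fp_foldl_bound _ _ Hl (pbound_enc Hl)); fp_go.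
by move=> x l1 l2 /size_enc_cat_le[le _]; rewrite foldl_consE cats0 size_enc_rev.
Qed.

Lemma fp_cat (l1 l2 : X -> seq A) : fp l1 -> fp l2 -> fp (fun x => l1 x ++ l2 x).
Proof.
move=> H1' H2'.
apply: (@fp_ext _ _ _ _ (fun x => foldl (fun s a => a :: s) (l2 x) (rev (l1 x)))).
  by move=> x; rewrite foldl_consE revK.
apply: (fp_foldl_bound _ H2' (fp_rev H1') (pbound_add (pbound_enc H1') (pbound_enc H2'))).
  by fp_go.
move=> x l3 l4 /size_enc_cat_le[le _].
by rewrite foldl_consE size_enc_cat size_enc_rev leq_add2r (leq_trans le) // size_enc_rev.
Qed.

End Lists.

Section Map.
Context (X A B : Type) `{Enc X} `{Enc A} `{Enc B}.

Lemma size_enc_app (f : X -> A -> B) (l : X -> seq A) :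
  fp (fun p : X * A => f p.1 p.2) -> fp l ->
  exists2 m, pbound m & forall x a, List.In a (l x) -> size (enc (f x a)) <= m x.
Proof.
move=> Hf Hl; have [c sz] := fp_size Hf.
exists (fun x => (2 * size (enc x) + size (enc (l x)) + 3) ^ c).
  apply: pbound_exp; apply: pbound_add (pbound_const _); apply: pbound_add (pbound_enc Hl).
  by apply: pbound_mul (pbound_const _) _; exact: (pbound_enc fp_id).
move=> x a al; have ale : size (enc a) <= size (enc (l x)) by exact: size_In_enc.
 apply: leq_trans (sz (x, a)) _.
case: c {sz} => // c; rewrite leq_exp2r // size_encP /=; lia.
Qed.

Lemma fp_map (f : X -> A -> B) (l : X -> seq A) :
  fp (fun p : X * A => f p.1 p.2) -> fp l -> fp (fun x => map (f x) (l x)).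
Proof.
move=> Hf Hl; have [m mb sz] := size_enc_app Hf Hl.
have fE x l1 : foldl (fun s a => f x a :: s) [::] l1 = rev (map (f x) l1).
  by elim/last_ind: l1 => // l1 a IH; rewrite foldl_rcons map_rcons rev_rcons IH.
apply: (@fp_ext _ _ _ _ (fun x => rev (foldl (fun s a => f x a :: s) [::] (l x)))).
  by move=> x; rewrite fE revK.
apply: fp_rev; apply: (fp_foldl_bound (m := fun x => size (l x) * (2 * m x).+1) _ _ Hl).
- fp_go; apply: (@fp_comp _ _ _ _ _ _ (fun p => f p.1 p.2) (fun x : X * (seq B * A) => (x.1, x.2.2))) => //.
  by fp_go.
- exact: fp_const.
- apply: pbound_mul (pbound_size Hl) _; apply: pbound_S.
  exact: pbound_mul (pbound_const _) mb.
move=> x l1 l2 lE; rewrite fE size_enc_rev.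
apply: leq_trans (size_enc_seq_le (k := m x) _) _.
  move=> b /List.in_map_iff[a [<- al]]; apply: sz; rewrite lE.
  by apply/List.in_or_app; left.
by rewrite size_map leq_mul2r lE size_cat leq_addr orbT.
Qed.

End Map.

Ltac fp_ops1 ::=
  lazymatch goal with
  | |- fp (fun x => rev (@?p x)) => apply: fp_rev
  | |- fp (fun x => cat (@?p x) (@?q x)) => apply: fp_cat
  end.

Section Booleans.
Context (X : Type) `{Enc X}.
Variables b c : X -> bool.
Hypotheses (Hb : fp b) (Hc : fp c).

Lemma fp_andb : fp (fun x => b x && c x).
Proof. exact: (fp_if Hb Hc (fp_const false)). Qed.

Lemma fp_orb : fp (fun x => b x || c x).
Proof. exact: (fp_if Hb (fp_const true) Hc). Qed.

Lemma fp_negb : fp (fun x => ~~ b x).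
Proof. exact: (fp_if Hb (fp_const false) (fp_const true)). Qed.

End Booleans.

Lemma fp_addb X `{Enc X} (b c : X -> bool) : fp b -> fp c -> fp (fun x => b x (+) c x).
Proof.
by move=> Hb Hc; apply: fp_ext (fp_if Hb (fp_negb Hc) Hc) => x; case: (b x).
Qed.

Ltac fp_ops1 ::=
  lazymatch goal with
  | |- fp (fun x => odd (@?p x)) => apply: fp_odd
  | |- fp (fun x => half (@?p x)) => apply: fp_half
  | |- fp (fun x => bits (@?p x)) => apply: fp_bits
  | |- fp (fun x => rev (@?p x)) => apply: fp_rev
  | |- fp (fun x => cat (@?p x) (@?q x)) => apply: fp_cat
  | |- fp (fun x => andb (@?p x) (@?q x)) => apply: fp_andb
  | |- fp (fun x => orb (@?p x) (@?q x)) => apply: fp_orb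
  | |- fp (fun x => negb (@?p x)) => apply: fp_negb
  | |- fp (fun x => addb (@?p x) (@?q x)) => apply: fp_addb
  end.

Section Arithmetic.

Lemma size_enc_half (n : nat) k : size (enc n) <= k -> size (enc n./2) <= k.
Proof.
rewrite !size_enc_nat; apply: leq_ltn_trans.
by rewrite -{2}[n]odd_double_half -addnn; lia.
Qed.

Lemma size_bits (n : nat) : size (bits n) = size (enc n).
Proof. by rewrite /enc /= /enc_nat size_map. Qed.

(** Digits are compared from the least significant one on; the last difference decides, so each
    difference overwrites the flag. *)
Definition leq_step (s : nat * (nat * bool)) (_ : bool) : nat * (nat * bool) :=
  (s.1./2, (s.2.1./2, if odd s.1 (+) odd s.2.1 then odd s.2.1 else s.2.2)).

Lemma half_mul a K x : a * K <= x./2 -> a * (2 * K) <= x.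
Proof.
move=> le; rewrite mulnCA -[x]odd_double_half -muln2 mulnC.
by apply: leq_trans (leq_addl _ _); rewrite leq_mul2r le orbT.
Qed.

Lemma leq_stepE l x y b : let s := foldl leq_step (x, (y, b)) l in
  [/\ (s.1 < s.2.1) || (s.1 == s.2.1) && s.2.2 = (x < y) || (x == y) && b,
      s.1 * 2 ^ size l <= x & s.2.1 * 2 ^ size l <= y].
Proof.
elim: l x y b => [|a l IH] x y b /=; first by rewrite !muln1.
have [-> le1 le2] := IH x./2 y./2 (if odd x (+) odd y then odd y else b).
have ex := odd_double_half x; have ey := odd_double_half y.
split.
- move: ex ey {le1 le2}; move: (x./2) (y./2) (odd x) (odd y) => x' y' o o' <- <-.
  by rewrite -!muln2; case: o; case: o' => /=; case: b => /=; lia.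
- by rewrite expnS; apply: half_mul le1.
- by rewrite expnS; apply: half_mul le2.
Qed.

Lemma mul_small a K x : a * K <= x -> x < K -> a = 0.
Proof. by case: a => // a; rewrite mulSn; lia. Qed.

(** The folded list is only a clock with at least as many ticks as either number has digits. The
    initial flag [true] is the answer for equal numbers. *)
Definition leq_bits x y := (foldl leq_step (x, (y, true)) (bits x ++ bits y)).2.2.

Lemma leq_bitsE x y : leq_bits x y = (x <= y).
Proof.
rewrite /leq_bits; have [] := leq_stepE (bits x ++ bits y) x y true.
set s := foldl _ _ _; rewrite size_cat !size_bits expnD => e le1 le2.
(* Each tick halves the number, so after as many ticks as it has digits nothing is left. *)
have s1 : s.1 = 0.
  apply: mul_small le1 (leq_trans (ltn_size_enc x) _).
  by rewrite leq_pmulr // expn_gt0.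
have s2 : s.2.1 = 0.
  apply: mul_small le2 (leq_trans (ltn_size_enc y) _).
  by rewrite leq_pmull // expn_gt0.
by move: e; rewrite s1 s2 /= andbT => ->; rewrite orbC -leq_eqVlt.
Qed.

Lemma fp_leq_ : fp (fun p : nat * nat => p.1 <= p.2).
Proof.
apply: (@fp_ext _ _ _ _ (fun p => leq_bits p.1 p.2)); first by move=> p; apply: leq_bitsE.
rewrite /leq_bits; apply: fp_2; apply: fp_2.
apply: (fp_foldl_bound (m := fun p => 5 * size (enc p) + 10)).
- by rewrite /leq_step; fp_go.
- by fp_go.
- by fp_go.
- apply: pbound_add (pbound_const _); apply: pbound_mul (pbound_const _) _.
  exact: (pbound_enc fp_id).
move=> [x y] l1 _ _ /=.
have [] := @foldl_inv _ _ (fun _ s => size (enc s.1) <= size (enc x) /\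
     size (enc s.2.1) <= size (enc y)) leq_step (x, (y, true)) l1.
- by move=> k s a [h1 h2]; split; apply: size_enc_half.
- by [].
set s := foldl _ _ _ => h1 h2; rewrite !size_encP /=.
by have : size (enc s.2.2) <= 1; [case: (s.2.2) | lia].
Qed.

(** Sum digits are produced from the least significant one and pushed, so the result is in the order
    that [msb_nat] reads. *)
Definition add_step (s : nat * (nat * (bool * seq bool))) (_ : bool) :=
  (s.1./2, (s.2.1./2,
    ((if odd s.1 then odd s.2.1 || s.2.2.1 else odd s.2.1 && s.2.2.1),
     ((odd s.1 (+) odd s.2.1) (+) s.2.2.1) :: s.2.2.2))).

Definition add_val (s : nat * (nat * (bool * seq bool))) := s.1 + s.2.1 + s.2.2.1.

Lemma add_stepE l s : let s' := foldl add_step s l in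
  [/\ msb_nat s'.2.2.2 + add_val s' * 2 ^ size s'.2.2.2 =
      msb_nat s.2.2.2 + add_val s * 2 ^ size s.2.2.2,
      add_val s' * 2 ^ size l <= add_val s &
      size s'.2.2.2 = size s.2.2.2 + size l].
Proof.
elim: l s => [|a l IH] [x [y [c o]]] /=; first by rewrite muln1 addn0.
have [-> le ->] := IH (add_step (x, (y, (c, o))) a).
have ex := odd_double_half x; have ey := odd_double_half y.
rewrite /= msb_nat_cons /= !expnS addnS; split => //.
- move: ex ey {le}; rewrite /add_val /=; move: (x./2) (y./2) (odd x) (odd y) => x' y' b b' <- <-.
  move: (msb_nat o) (2 ^ _) => m K; rewrite -!muln2.
  by case: b; case: b'; case: c => /=; nia.
apply: half_mul; apply: (leq_trans le) => {le}.
rewrite geq_half_double /add_val /=; move: ex ey.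
move: (x./2) (y./2) (odd x) (odd y) => x' y' b b' <- <-.
by rewrite -!muln2; case: b; case: b'; case: c => /=; lia.
Qed.

(** Again the list is a clock; its extra head leaves room for the final carry. *)
Definition add_bits x y :=
  msb_nat (foldl add_step (x, (y, (false, [::]))) (true :: bits x ++ bits y)).2.2.2.

Lemma add_bitsE x y : add_bits x y = x + y.
Proof.
rewrite /add_bits; have [] := add_stepE (true :: bits x ++ bits y) (x, (y, (false, [::]))).
set s := foldl _ _ _; rewrite /add_val /= size_cat !size_bits addn0 muln1 add0n => e le _.
have xy : x + y < 2 ^ (size (enc x) + size (enc y)).+1.
  have := ltn_size_enc x; have := ltn_size_enc y; rewrite expnS expnD.
  have : 0 < 2 ^ size (enc x) by rewrite expn_gt0.
  have : 0 < 2 ^ size (enc y) by rewrite expn_gt0.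
  by move: (2 ^ _) (2 ^ _) => A B; nia.
by move: e; rewrite (mul_small le xy) mul0n addn0.
Qed.

Lemma fp_msb_nat_ : fp msb_nat.
Proof.
apply: (fp_foldl_bound (l := fun l : seq bool => l) (init := fun _ => 0)
         (step := fun _ n (b : bool) => b + n.*2) (m := fun l => size (enc l))).
- by apply: fp_bit_double; fp_go.
- exact: fp_const.
- exact: fp_id.
- exact: (pbound_enc fp_id).
move=> l l1 l2 /size_enc_cat_le[le _].
rewrite size_enc_nat -/(msb_nat l1); apply: leq_trans (msb_nat_ub l1) _.
by rewrite leq_exp2l // (leq_trans (size_le_enc _) le).
Qed.

Lemma fp_msb_nat X `{Enc X} (f : X -> seq bool) : fp f -> fp (fun x => msb_nat (f x)).
Proof. by move=> Hf; exact: (fp_comp fp_msb_nat_ Hf). Qed.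

Lemma size_enc_bools (l : seq bool) : size (enc l) <= 3 * size l.
Proof. by elim: l => // b l IH; rewrite size_enc_cons; case: b => /=; lia. Qed.

Lemma size_enc_bool (b : bool) : size (enc b) <= 1.
Proof. by case: b. Qed.

Lemma fp_add_ : fp (fun p : nat * nat => p.1 + p.2).
Proof.
apply: (@fp_ext _ _ _ _ (fun p => add_bits p.1 p.2)); first by move=> p; apply: add_bitsE.
rewrite /add_bits; apply: fp_msb_nat; do 3 apply: fp_2.
apply: (fp_foldl_bound (m := fun p => 20 * size (enc p) + 20)).
- by rewrite /add_step; fp_go.
- by fp_go.
- by fp_go.
- apply: pbound_add (pbound_const _); apply: pbound_mul (pbound_const _) _.
  exact: (pbound_enc fp_id).
move=> [x y] l1 l2 /= lE.
have [] := @foldl_inv _ _ (fun k s => [/\ size (enc s.1) <= size (enc x),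
     size (enc s.2.1) <= size (enc y) & size s.2.2.2 = k])
     add_step (x, (y, (false, [::]))) l1.
- by move=> k s a [h1 h2 <-]; split=> //; apply: size_enc_half.
- by [].
set s := foldl _ _ _ => h1 h2 h3; rewrite !size_encP /=.
have := size_enc_bool s.2.2.1; have := size_enc_bools s.2.2.2.
have := congr1 size lE; rewrite h3 /= !size_cat !size_bits; lia.
Qed.

Definition mul_bits x y :=
  foldl (fun acc (b : bool) => (acc + acc) + if b then y else 0) 0 (rev (bits x)).

Lemma mul_bits_prefix y l :
  foldl (fun acc (b : bool) => (acc + acc) + if b then y else 0) 0 l = msb_nat l * y.
Proof.
elim/last_ind: l => // l b IH; rewrite foldl_rcons IH /msb_nat foldl_rcons -/(msb_nat _).
by case: b; rewrite -muln2; lia.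
Qed.

Lemma mul_bitsE x y : mul_bits x y = x * y.
Proof. by rewrite /mul_bits mul_bits_prefix msb_nat_bits. Qed.

End Arithmetic.

Section Applicative.
Context (X : Type) `{Enc X}.
Implicit Types f g : X -> nat.

Lemma fp_add f g : fp f -> fp g -> fp (fun x => f x + g x).
Proof. by move=> Hf Hg; exact: (fp_comp2 (op := addn) fp_add_ Hf Hg). Qed.

Lemma fp_leq f g : fp f -> fp g -> fp (fun x => f x <= g x).
Proof. by move=> Hf Hg; exact: (fp_comp2 (op := leq) fp_leq_ Hf Hg). Qed.

Lemma fp_eqn f g : fp f -> fp g -> fp (fun x => f x == g x).
Proof.
move=> Hf Hg; apply: fp_ext (fp_andb (fp_leq Hf Hg) (fp_leq Hg Hf)) => x.
by rewrite -eqn_leq.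
Qed.

Lemma fp_succ f : fp f -> fp (fun x => (f x).+1).
Proof. by move=> Hf; apply: fp_ext (fp_add (fp_const 1) Hf) => x; rewrite add1n. Qed.

End Applicative.

Ltac fp_ops2 ::=
  lazymatch goal with
  | |- fp (fun x => addn (@?p x) (@?q x)) => apply: fp_add
  | |- fp (fun x => leq (@?p x) (@?q x)) => apply: fp_leq
  | |- fp (fun x => eq_op (@?p x) (@?q x)) => apply: fp_eqn
  | |- fp (fun x => S (@?p x)) => apply: fp_succ
  end.

Lemma fp_mul_ : fp (fun p : nat * nat => p.1 * p.2).
Proof.
apply: (@fp_ext _ _ _ _ (fun p => mul_bits p.1 p.2)); first by move=> p; apply: mul_bitsE.
rewrite /mul_bits.
apply: (fp_foldl_bound (m := fun p => size (enc p.1) + size (enc p.2))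
  (step := fun (p : nat * nat) acc (b : bool) => (acc + acc) + if b then p.2 else 0)).
- by fp_go.
- by fp_go.
- by fp_go.
- by apply: pbound_add; apply: pbound_enc; fp_go.
move=> [x y] l1 l2 /= lE; rewrite mul_bits_prefix size_enc_nat expnD.
apply: ltn_mul (ltn_size_enc y); apply: leq_trans (msb_nat_ub _) _.
have := congr1 size lE; rewrite size_rev size_bits size_cat => ->.
by rewrite leq_exp2l // leq_addr.
Qed.

Lemma fp_mul X `{Enc X} (f g : X -> nat) : fp f -> fp g -> fp (fun x => f x * g x).
Proof. by move=> Hf Hg; exact: (fp_comp2 (op := muln) fp_mul_ Hf Hg). Qed.
Ltac fp_ops2 ::=
  lazymatch goal with
  | |- fp (fun x => addn (@?p x) (@?q x)) => apply: fp_add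
  | |- fp (fun x => leq (@?p x) (@?q x)) => apply: fp_leq
  | |- fp (fun x => eq_op (@?p x) (@?q x)) => apply: fp_eqn
  | |- fp (fun x => S (@?p x)) => apply: fp_succ
  | |- fp (fun x => muln (@?p x) (@?q x)) => apply: fp_mul
  end.

(** * Lists *)

Ltac fp_ops3 ::=
  lazymatch goal with
  | |- fp (fun x => map (@?p x) (@?q x)) => apply: fp_map
  end.

Section MoreLists.
Context (X A : Type) `{Enc X} `{Enc A}.

Lemma fp_flatten (l : X -> seq (seq A)) : fp l -> fp (fun x => flatten (l x)).
Proof.
move=> Hl.
have fE l1 : foldl (fun s l => s ++ l) [::] l1 = flatten l1 :> seq A.
  by elim/last_ind: l1 => // l1 a IH; rewrite foldl_rcons IH flatten_rcons.
apply: (@fp_ext _ _ _ _ (fun x => foldl (fun s l => s ++ l) [::] (l x))) => //.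
apply: (fp_foldl_bound _ _ Hl (pbound_enc Hl)); fp_go.
move=> x l1 l2 /size_enc_cat_le[le _]; rewrite fE; apply: leq_trans le.
elim: l1 => // a l1 IH; rewrite size_enc_cons -[flatten _]/(a ++ flatten l1).
by rewrite size_enc_cat; lia.
Qed.

Lemma fp_filter (p : X -> A -> bool) (l : X -> seq A) :
  fp (fun q : X * A => p q.1 q.2) -> fp l -> fp (fun x => [seq a <- l x | p x a]).
Proof.
move=> Hp Hl.
apply: (@fp_ext _ _ _ _ (fun x => flatten [seq if p x a then [:: a] else [::] | a <- l x])).
  by move=> x; elim: (l x) => //= a l' ->; case: (p x a).
by apply: fp_flatten; apply: fp_map => //; apply: fp_if => //; fp_go.
Qed.

Lemma fp_has (p : X -> A -> bool) (l : X -> seq A) :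
  fp (fun q : X * A => p q.1 q.2) -> fp l -> fp (fun x => has (p x) (l x)).
Proof.
move=> Hp Hl.
apply: (@fp_ext _ _ _ _ (fun x => ~~ nilp [seq a <- l x | p x a])).
  by move=> x; rewrite has_count -size_filter lt0n.
by apply: fp_negb; apply: (fp_comp (fp_nilp (A := A))); apply: fp_filter.
Qed.

Lemma fp_seqsize (l : X -> seq A) : fp l -> fp (fun x => size (l x)).
Proof.
move=> Hl.
have fE l1 n : foldl (fun s (_ : A) => s.+1) n l1 = n + size l1.
  by elim: l1 n => [|a l1 IH] n; rewrite ?addn0 //= IH addSnnS.
apply: (@fp_ext _ _ _ _ (fun x => foldl (fun s (_ : A) => s.+1) 0 (l x))).
  by move=> x; rewrite fE.
apply: (fp_foldl_bound _ _ Hl (pbound_size Hl)); fp_go.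
move=> x l1 l2 ->; rewrite fE size_cat; apply: leq_trans (size_enc_nat_le _) _.
exact: leq_addr.
Qed.

(** Ranges are measured by a list: numbers are binary, so [iota 0 n] may be exponentially longer
    than [n]. *)
Definition indices (l : seq A) : seq nat := iota 0 (size l).

Lemma indicesE l : foldl (fun s _ => s ++ [:: size s]) [::] l = indices l.
Proof.
rewrite /indices; elim/last_ind: l => // l a IH.
by rewrite foldl_rcons size_rcons IH size_iota -addn1 iotaD.
Qed.

Lemma size_enc_nats (l : seq nat) k : all (leq^~ k) l -> size (enc l) <= size l * (2 * k).+1.
Proof.
move=> lk; apply: size_enc_seq_le => a al.
apply: leq_trans (size_enc_nat_le a) _.
by elim: l lk al => //= b l IH /andP[bk lk] [<-|/(IH lk)].
Qed.

End MoreLists.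

Section MoreLists2.
Context (X A : Type) `{Enc X} `{Enc A}.

Lemma fp_indices (l : X -> seq A) : fp l -> fp (fun x => indices (l x)).
Proof.
move=> Hl.
apply: (@fp_ext _ _ _ _ (fun x => foldl (fun s _ => s ++ [:: size s]) [::] (l x))).
  by move=> x; rewrite indicesE.
apply: (fp_foldl_bound (m := fun x => size (l x) * (2 * size (l x)).+1) _ _ Hl).
- by apply: fp_cat; [fp_go | apply: fp_cons; [apply: fp_seqsize|]; fp_go].
- by fp_go.
- apply: pbound_mul (pbound_size Hl) _; apply: pbound_S.
  exact: pbound_mul (pbound_const _) (pbound_size Hl).
move=> x l1 l2 lE; rewrite indicesE.
apply: leq_trans (size_enc_nats (k := size (l x)) _) _.
  by apply/allP => i; rewrite mem_iota lE size_cat; lia.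
by rewrite size_iota lE size_cat leq_mul2r leq_addr orbT.
Qed.

Lemma fp_nth (d : A) (l : X -> seq A) (n : X -> nat) :
  fp l -> fp n -> fp (fun x => nth d (l x) (n x)).
Proof.
move=> Hl Hn.
pose step n (s : nat * A) a := (s.1.+1, if s.1 == n then a else s.2).
have stepE l1 k m b : foldl (step m) (k, b) l1 =
    (k + size l1, if k <= m < k + size l1 then nth d l1 (m - k) else b).
  elim: l1 k b => [|a l1 IH] k b /=; first by rewrite addn0 ltnNge andbN.
  rewrite IH addSnnS; congr pair; case: (ltngtP k m) => //= km.
    by rewrite -(subnSK km).
  by rewrite km subnn addnS ltnS leq_addr.
apply: (@fp_ext _ _ _ _ (fun x => (foldl (step (n x)) (0, d) (l x)).2)).
  by move=> x; rewrite stepE /= add0n subn0; case: ltnP => // ?; rewrite nth_default.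
apply: fp_2.
apply: (fp_foldl_bound (m := fun x => 2 * size (l x) + 1 + (size (enc (l x)) + size (enc d))) _ _ Hl).
- rewrite /step; fp_go.
- by fp_go.
- apply: pbound_add; apply: pbound_add; try exact: pbound_const.
    exact: pbound_mul (pbound_const _) (pbound_size Hl).
  exact: pbound_enc.
move=> x l1 l2 lE; rewrite stepE size_encP /=.
have s1 : size (enc (0 + size l1)) <= size (l x).
  by apply: leq_trans (size_enc_nat_le _) _; rewrite lE size_cat leq_addr.
have s2 : size (enc (if n x < 0 + size l1 then nth d l1 (n x - 0) else d)) <=
       size (enc (l x)) + size (enc d); last by lia.
case: ifP => [lt|_]; last by exact: leq_addl.
apply: leq_trans (leq_addr _ _); rewrite lE size_enc_cat; apply: leq_trans (leq_addr _ _).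
rewrite subn0 add0n in lt *; elim: l1 (n x) lt {lE s1} => // a l1 IH [|k] lt; rewrite size_enc_cons /=.
  by lia.
by have := IH k lt; lia.
Qed.

End MoreLists2.

Ltac fp_ops3 ::=
  lazymatch goal with
  | |- fp (fun x => map (@?p x) (@?q x)) => apply: fp_map
  | |- fp (fun x => flatten (@?p x)) => apply: fp_flatten
  | |- fp (fun x => filter (@?p x) (@?q x)) => apply: fp_filter
  | |- fp (fun x => has (@?p x) (@?q x)) => apply: fp_has
  | |- fp (fun x => size (@?p x)) => apply: fp_seqsize
  | |- fp (fun x => indices (@?p x)) => apply: fp_indices
  | |- fp (fun x => nth ?d (@?p x) (@?q x)) => apply: fp_nth
  end.

(** * The algorithm and its cost *)

(* [(n, d)] stands for the rational n / d and is never reduced; sizes stay polynomial because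
   numerator plus denominator is submultiplicative under [fadd] and [fmul]. *)
Notation fracn := (nat * nat)%type.
Definition frac0 : fracn := (0, 1).
Definition fadd (a b : fracn) : fracn := (a.1 * b.2 + b.1 * a.2, a.2 * b.2).
Definition fmul (a b : fracn) : fracn := (a.1 * b.1, a.2 * b.2).
Definition fle (a b : fracn) : bool := a.1 * b.2 <= b.1 * a.2.
Definition fsum (l : seq fracn) : fracn := foldl fadd frac0 l.

(* Contribution to (welfare, revenue) of the line [col] of the table when it is sold
   to the bidder with values [v] from threshold [a] on. *)
Definition line_weight (v col : seq fracn) (a : nat) : fracn * fracn :=
  (fsum [seq if a <= i then fmul (nth frac0 col i) (nth frac0 v i) else frac0
        | i <- indices v],
   fmul (nth frac0 v a)
     (fsum [seq if a <= i then nth frac0 col i else frac0 | i <- indices v])).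

Definition column (f : seq (seq fracn)) (j : nat) : seq fracn := [seq nth frac0 row j | row <- f].

(* The largest c <= M with c S / M <= s (M in unary). *)
Definition round_to (S : fracn) (M : seq unit) (s : fracn) : nat :=
  foldl (fun c _ => if fle (c.+1 * S.1, S.2) (size M * s.1, s.2) then c.+1 else c) 0 M.

(* Thresholds of columns and of rows crossed so far by a monotone lattice path, latest first,
   with the rounded welfare and revenue collected. *)
Notation state := (seq nat * (seq nat * (nat * nat)))%type.

(** The dummy entry of [frac0 :: v1] admits the threshold [size v1], for a line in which the bidder
    never wins; likewise for [v2]. *)
Definition candidates (v1 v2 : seq fracn) (f : seq (seq fracn)) (st : state) :
    seq (seq nat * (seq nat * (fracn * fracn))) :=
  (if size st.1 < size v2 then
     [seq (a :: st.1, (st.2.1, line_weight v1 (column f (size st.1)) a))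
     | a <- [seq a <- indices (frac0 :: v1) | size st.2.1 <= a]]
   else [::]) ++
  (if size st.2.1 < size v1 then
     [seq (st.1, (b :: st.2.1, line_weight v2 (nth [::] f (size st.2.1)) b))
     | b <- [seq b <- indices (frac0 :: v2) | size st.1 <= b]]
   else [::]).

Definition below (S R : fracn) (w : fracn * fracn) : bool := fle w.1 S && fle w.2 R.

Definition expand v1 v2 f M (S R : fracn) (st : state) : seq state :=
  [seq (c.1, (c.2.1, (st.2.2.1 + round_to S M c.2.2.1, st.2.2.2 + round_to R M c.2.2.2)))
  | c <- [seq c <- candidates v1 v2 f st | below S R c.2.2]].

(** Within one generation all states have crossed equally many lines, so the number of crossed rows
    determines the position and with it all continuations. *)
Definition same_key (s t : state) : bool :=
  [&& size s.2.1 == size t.2.1, s.2.2.1 == t.2.2.1 & s.2.2.2 == t.2.2.2].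

Definition dedup (l : seq state) : seq state :=
  foldl (fun acc s => if has (same_key s) acc then acc else s :: acc) [::] l.

Definition next_states v1 v2 f M S R (l : seq state) : seq state :=
  dedup (flatten [seq expand v1 v2 f M S R s | s <- l]).

(** The list [v1 ++ v2] is a clock: every complete lattice path has [size v1 + size v2] steps. *)
Definition states v1 v2 f M S R : seq state :=
  foldl (fun l _ => next_states v1 v2 f M S R l) [:: ([::], ([::], (0, 0)))] (v1 ++ v2).

Definition table_of (v1 v2 : seq fracn) (s : state) : seq (seq nat) :=
  [seq [seq if nth 0 (rev s.1) j <= i then 1 else if nth 0 (rev s.2.1) i <= j then 2 else 0
       | j <- indices v2] | i <- indices v1].

Definition weights v1 v2 f : seq (fracn * fracn) :=
  flatten [seq [seq line_weight v1 (column f j) a | a <- indices (frac0 :: v1)]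
          | j <- indices v2] ++
  flatten [seq [seq line_weight v2 (nth [::] f i) b | b <- indices (frac0 :: v2)]
          | i <- indices v1].

(** [pad] is K in unary; one copy per line of the table gives M. The welfare part of [w] and the
    revenue part of [w'] are the two guesses. *)
Definition tables (pad : seq unit) (v1 v2 : seq fracn) (f : seq (seq fracn)) :
    seq (seq (seq nat)) :=
  flatten [seq flatten [seq [seq table_of v1 v2 s
    | s <- states v1 v2 f (flatten [seq pad | _ <- v1 ++ v2]) w.1 w'.2]
    | w' <- weights v1 v2 f] | w <- weights v1 v2 f].

Section Cost.
Context (X : Type) `{Enc X}.

Lemma fp_fadd (a b : X -> fracn) : fp a -> fp b -> fp (fun x => fadd (a x) (b x)).
Proof. move=> Ha Hb; rewrite /fadd; fp_go. Qed.

Lemma fp_fmul (a b : X -> fracn) : fp a -> fp b -> fp (fun x => fmul (a x) (b x)).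
Proof. move=> Ha Hb; rewrite /fmul; fp_go. Qed.

Lemma fp_fle (a b : X -> fracn) : fp a -> fp b -> fp (fun x => fle (a x) (b x)).
Proof. move=> Ha Hb; rewrite /fle; fp_go. Qed.

End Cost.

Lemma fsum_bound (l : seq fracn) : (fsum l).1 + (fsum l).2 <= 2 ^ size (enc l).
Proof.
elim/last_ind: l => [|l a IH] //.
rewrite /fsum foldl_rcons -/(fsum l) -cats1 size_enc_cat expnD.
have ha : a.1 + a.2 <= 2 ^ size (enc [:: a]).
  have := ltn_size_enc a.1; have := ltn_size_enc a.2.
  rewrite size_enc_cons size_encP; set u := size (enc a.1); set w := size (enc a.2) => h1 h2.
  apply: (@leq_trans (2 ^ (u + w).+1)); last by rewrite leq_exp2l //; lia.
  have : 2 ^ u <= 2 ^ (u + w) by rewrite leq_exp2l //; lia.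
  have : 2 ^ w <= 2 ^ (u + w) by rewrite leq_exp2l //; lia.
  by rewrite expnS; lia.
apply: leq_trans (leq_mul IH ha).
by rewrite /fadd /=; nia.
Qed.

Lemma fp_fsum X `{Enc X} (l : X -> seq fracn) : fp l -> fp (fun x => fsum (l x)).
Proof.
move=> Hl.
apply: (fp_foldl_bound (m := fun x => 3 * size (enc (l x)) + 4) _ _ Hl).
- by apply: fp_fadd; fp_go.
- by fp_go.
- apply: pbound_add (pbound_const _); apply: pbound_mul (pbound_const _) _.
  exact: pbound_enc.
move=> x l1 l2 /size_enc_cat_le[le _]; rewrite -/(fsum l1) size_encP.
have b := fsum_bound l1; have p0 : 0 < 2 ^ size (enc l1) by rewrite expn_gt0.
have h1 : size (enc (fsum l1).1) <= (size (enc l1)).+1.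
  by rewrite size_enc_nat expnS; lia.
have h2 : size (enc (fsum l1).2) <= (size (enc l1)).+1.
  by rewrite size_enc_nat expnS; lia.
by move: (size (enc (fsum l1).1)) (size (enc (fsum l1).2)) h1 h2 => p q; lia.
Qed.

Ltac fp_ops4 :=
  lazymatch goal with
  | |- fp (fun x => fadd (@?p x) (@?q x)) => apply: fp_fadd
  | |- fp (fun x => fmul (@?p x) (@?q x)) => apply: fp_fmul
  | |- fp (fun x => fle (@?p x) (@?q x)) => apply: fp_fle
  | |- fp (fun x => fsum (@?p x)) => apply: fp_fsum
  end.
Ltac fp_ops3 ::=
  lazymatch goal with
  | |- fp (fun x => map (@?p x) (@?q x)) => apply: fp_map
  | |- fp (fun x => flatten (@?p x)) => apply: fp_flatten
  | |- fp (fun x => filter (@?p x) (@?q x)) => apply: fp_filter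
  | |- fp (fun x => has (@?p x) (@?q x)) => apply: fp_has
  | |- fp (fun x => size (@?p x)) => apply: fp_seqsize
  | |- fp (fun x => indices (@?p x)) => apply: fp_indices
  | |- fp (fun x => nth ?d (@?p x) (@?q x)) => apply: fp_nth
  | _ => fp_ops4
  end.

Section Cost2.
Context (X : Type) `{Enc X}.

Lemma fp_line_weight (v col : X -> seq fracn) (a : X -> nat) :
  fp v -> fp col -> fp a -> fp (fun x => line_weight (v x) (col x) (a x)).
Proof. 
by move=> Hv Hc Ha; rewrite /line_weight; fp_go.
Qed.

Lemma fp_column (f : X -> seq (seq fracn)) (j : X -> nat) :
  fp f -> fp j -> fp (fun x => column (f x) (j x)).
Proof. by move=> Hf Hj; rewrite /column; fp_go. Qed.

Lemma fp_round_to (S s : X -> fracn) (M : X -> seq unit) :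
  fp S -> fp M -> fp s -> fp (fun x => round_to (S x) (M x) (s x)).
Proof.
move=> HS HM Hs; rewrite /round_to.
apply: (fp_foldl_bound (m := fun x => size (M x)) (step := fun x c (_ : unit) =>
  if fle (c.+1 * (S x).1, (S x).2) (size (M x) * (s x).1, (s x).2) then c.+1 else c)) => //.
- by fp_go.
- by fp_go.
- exact: pbound_size.
move=> x l1 l2 lE; apply: leq_trans (size_enc_nat_le _) _.
apply: (@leq_trans (size l1)); last by rewrite lE size_cat leq_addr.
apply: (@foldl_inv _ _ (fun k c => c <= k)) => // k c _ ck.
by case: ifP => _ //; apply: leqW.
Qed.

Lemma fp_below (S R : X -> fracn) (w : X -> fracn * fracn) :
  fp S -> fp R -> fp w -> fp (fun x => below (S x) (R x) (w x)).
Proof. by move=> HS HR Hw; rewrite /below; fp_go. Qed.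

End Cost2.

Lemma round_to_le S M s : round_to S M s <= size M.
Proof.
by apply: (@foldl_inv _ _ (fun k c => c <= k)) => // k c _ ck; case: ifP => _ //; apply: leqW.
Qed.

Ltac fp_ops4 ::=
  lazymatch goal with
  | |- fp (fun x => fadd (@?p x) (@?q x)) => apply: fp_fadd
  | |- fp (fun x => fmul (@?p x) (@?q x)) => apply: fp_fmul
  | |- fp (fun x => fle (@?p x) (@?q x)) => apply: fp_fle
  | |- fp (fun x => fsum (@?p x)) => apply: fp_fsum
  | |- fp (fun x => line_weight (@?p x) (@?q x) (@?r x)) => apply: fp_line_weight
  | |- fp (fun x => column (@?p x) (@?q x)) => apply: fp_column
  | |- fp (fun x => round_to (@?p x) (@?q x) (@?r x)) => apply: fp_round_to
  | |- fp (fun x => below (@?p x) (@?q x) (@?r x)) => apply: fp_below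
  end.

Section Cost3.
Context (X : Type) `{Enc X}.
Variables (v1 v2 : X -> seq fracn) (f : X -> seq (seq fracn)).
Hypotheses (Hv1 : fp v1) (Hv2 : fp v2) (Hf : fp f).

Lemma fp_candidates (s : X -> state) :
  fp s -> fp (fun x => candidates (v1 x) (v2 x) (f x) (s x)).
Proof. by move=> Hs; rewrite /candidates; fp_go. Qed.

Lemma fp_weights : fp (fun x => weights (v1 x) (v2 x) (f x)).
Proof. by rewrite /weights; fp_go. Qed.

Lemma fp_table_of (s : X -> state) : fp s -> fp (fun x => table_of (v1 x) (v2 x) (s x)).
Proof. by move=> Hs; rewrite /table_of; fp_go. Qed.

End Cost3.
Definition key (s : state) : nat * (nat * nat) := (size s.2.1, (s.2.2.1, s.2.2.2)).

Lemma same_keyE s t : same_key s t = (key s == key t).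
Proof. by []. Qed.

Lemma dedup_rcons l s :
  dedup (rcons l s) = if has (same_key s) (dedup l) then dedup l else s :: dedup l.
Proof. by rewrite /dedup foldl_rcons. Qed.

Lemma dedup_uniq l : uniq (map key (dedup l)).
Proof.
elim/last_ind: l => // l s IH; rewrite dedup_rcons.
case: ifPn => // /hasPn h; rewrite /= IH andbT.
by apply/mapP => -[t /h]; rewrite same_keyE => /eqP ne e; apply: ne.
Qed.

Lemma dedup_sub l : {subset dedup l <= l}.
Proof.
elim/last_ind: l => // l s IH t; rewrite dedup_rcons mem_rcons inE.
case: ifP => _; first by move=> /IH ->; rewrite orbT.
by rewrite inE => /predU1P[->|/IH ->]; rewrite ?eqxx ?orbT.
Qed.

Lemma dedup_key l s : s \in l -> exists2 t, t \in dedup l & key t = key s.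
Proof.
elim/last_ind: l => // l t IH; rewrite mem_rcons inE dedup_rcons => /predU1P[->|/IH[u ul ku]].
  case: ifP => [/hasP[u ul]|_]; last by exists t; rewrite // mem_head.
  by rewrite same_keyE => /eqP ku; exists u.
by exists u => //; case: ifP => // _; rewrite inE ul orbT.
Qed.

Lemma size_enc_dedup l : size (enc (dedup l)) <= size (enc l).
Proof.
elim/last_ind: l => // l s IH; rewrite dedup_rcons -cats1 size_enc_cat.
by case: ifP => _; rewrite ?size_enc_cons; lia.
Qed.

Lemma mem_indices T (l : seq T) i : (i \in indices l) = (i < size l).
Proof. by rewrite mem_iota. Qed.

Lemma candidatesP v1 v2 f (s : state) c : reflect
  ((exists a, [/\ size s.1 < size v2, size s.2.1 <= a <= size v1 &
     c = (a :: s.1, (s.2.1, line_weight v1 (column f (size s.1)) a))]) \/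
   (exists b, [/\ size s.2.1 < size v1, size s.1 <= b <= size v2 &
     c = (s.1, (b :: s.2.1, line_weight v2 (nth [::] f (size s.2.1)) b))]))
  (c \in candidates v1 v2 f s).
Proof.
rewrite /candidates mem_cat; apply: (iffP orP) => -[].
- case: ifP => // lt /mapP[a]; rewrite mem_filter mem_indices ltnS => ha ->.
  by left; exists a.
- case: ifP => // lt /mapP[a]; rewrite mem_filter mem_indices ltnS => ha ->.
  by right; exists a.
- case=> a [lt ha ->]; left; rewrite lt; apply/mapP; exists a => //.
  by rewrite mem_filter mem_indices ltnS.
- case=> a [lt ha ->]; right; rewrite lt; apply/mapP; exists a => //.
  by rewrite mem_filter mem_indices ltnS.
Qed.

(** * Number and size of the states kept *)

Section StatesBound.
Variables (v1 v2 : seq fracn) (f : seq (seq fracn)) (M : seq unit) (S R : fracn).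

Definition bounded_state k (s : state) : bool :=
  [&& size s.1 <= k, size s.2.1 <= k, all (leq^~ (size v1)) s.1,
      all (leq^~ (size v2)) s.2.1, s.2.2.1 <= k * size M & s.2.2.2 <= k * size M].

Lemma bounded_expand k s t : bounded_state k s -> t \in expand v1 v2 f M S R s ->
  bounded_state k.+1 t.
Proof.
case/and5P=> h1 h2 h3 h4 /andP[h5 h6] /mapP[c]; rewrite mem_filter => /andP[_ cs] ->.
have rS := round_to_le S M; have rR := round_to_le R M.
rewrite /bounded_state /= !mulSn !(addnC (size M)) !leq_add //.
by case/candidatesP: cs => -[a [_ /andP[_ le] ->]] /=; rewrite ?ltnS ?h1 ?h2 ?(leqW h1) ?(leqW h2) ?h3 ?h4 ?le.
Qed.

Lemma bounded_next k l : all (bounded_state k) l ->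
  all (bounded_state k.+1) (next_states v1 v2 f M S R l).
Proof.
move=> /allP lk; apply/allP => t /dedup_sub/flatten_mapP[s sl].
exact/bounded_expand/lk.
Qed.

(** The keys are distinct and lie in a box, whose sides are polynomial because the totals are
    rounded. *)
Lemma size_bounded k l : all (bounded_state k) l -> uniq (map key l) ->
  size l <= k.+1 * ((k * size M).+1 * (k * size M).+1).
Proof.
move=> /allP lk un; set N := k * size M.
rewrite -(size_map key) -[k.+1](size_iota 0) -[N.+1](size_iota 0).
set I := iota 0 N.+1.
apply: leq_trans (_ : size [seq (i, p) | i <- iota 0 k.+1, p <- [seq (a, b) | a <- I, b <- I]] <= _).
  apply: uniq_leq_size un _ => _ /mapP[s /lk/and5P[_ h2 _ _ /andP[h5 h6]] ->].
  apply: allpairs_f; first by rewrite mem_iota.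
  by apply: allpairs_f; rewrite mem_iota.
by rewrite !size_allpairs.
Qed.

Lemma size_enc_bounded k s : bounded_state k s ->
  size (enc s) <= 4 * (k * (2 * (size v1 + size v2)).+1) + 3 * (k * size M) + 3.
Proof.
case/and5P=> h1 h2 h3 h4 /andP[h5 h6].
set H := size v1 + size v2.
have e1 : size (enc s.1) <= k * (2 * H).+1.
  apply: leq_trans (size_enc_nats (k := H) _) _; last by rewrite leq_mul2r h1 orbT.
  by apply: sub_all h3 => i /leq_trans; apply; exact: leq_addr.
have e2 : size (enc s.2.1) <= k * (2 * H).+1.
  apply: leq_trans (size_enc_nats (k := H) _) _; last by rewrite leq_mul2r h2 orbT.
  by apply: sub_all h4 => i /leq_trans; apply; exact: leq_addl.
have e3 := leq_trans (size_enc_nat_le _) h5; have e4 := leq_trans (size_enc_nat_le _) h6.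
rewrite !size_encP; move: e1 e2 e3 e4.
move: (size (enc s.1)) (size (enc s.2.1)) (size (enc s.2.2.1)) (size (enc s.2.2.2)).
by move: (k * _) (k * _) => *; lia.
Qed.

Lemma states_prefix (l : seq fracn) :
  let r := foldl (fun l _ => next_states v1 v2 f M S R l) [:: ([::], ([::], (0, 0)))] l in
  all (bounded_state (size l)) r /\ uniq (map key r).
Proof.
move=> r; rewrite {}/r.
apply: (@foldl_inv (seq state) fracn
  (fun k (r : seq state) => all (bounded_state k) r /\ uniq (map key r))) => //.
by move=> k r _ [h _]; split; [exact: bounded_next | exact: dedup_uniq].
Qed.

End StatesBound.

Lemma fp_same_key X `{Enc X} (s t : X -> state) : fp s -> fp t -> fp (fun x => same_key (s x) (t x)).
Proof. by move=> Hs Ht; rewrite /same_key; fp_go. Qed.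

Section Cost4.
Context (X : Type) `{Enc X}.

Lemma fp_dedup (l : X -> seq state) : fp l -> fp (fun x => dedup (l x)).
Proof.
move=> Hl; rewrite /dedup.
apply: (fp_foldl_bound _ _ Hl (pbound_enc Hl)).
- apply: fp_if; last by fp_go.
    by apply: fp_has; [apply: fp_same_key|]; fp_go.
  by fp_go.
- by fp_go.
by move=> x l1 l2 /size_enc_cat_le[le _]; apply: leq_trans (size_enc_dedup l1) le.
Qed.

Variables (v1 v2 : X -> seq fracn) (f : X -> seq (seq fracn)) (M : X -> seq unit).
Variables (S R : X -> fracn).
Hypotheses (Hv1 : fp v1) (Hv2 : fp v2) (Hf : fp f) (HM : fp M) (HS : fp S) (HR : fp R).

Lemma fp_expand (s : X -> state) : fp s ->
  fp (fun x => expand (v1 x) (v2 x) (f x) (M x) (S x) (R x) (s x)).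
Proof.
move=> Hs; rewrite /expand; fp_go.
exact: fp_candidates.
Qed.

End Cost4.

Section Cost5.
Context (X : Type) `{Enc X}.
Variables (v1 v2 : X -> seq fracn) (f : X -> seq (seq fracn)) (M : X -> seq unit).
Variables (S R : X -> fracn).
Hypotheses (Hv1 : fp v1) (Hv2 : fp v2) (Hf : fp f) (HM : fp M) (HS : fp S) (HR : fp R).

Lemma fp_next_states (l : X -> seq state) : fp l ->
  fp (fun x => next_states (v1 x) (v2 x) (f x) (M x) (S x) (R x) (l x)).
Proof.
move=> Hl; rewrite /next_states; apply: fp_dedup; apply: fp_flatten; apply: fp_map => //.
by apply: fp_expand; fp_go.
Qed.

End Cost5.

(** Because [dedup] follows every expansion, each generation is bounded by the number of keys times
    the size of one state, which is the accumulator bound that the fold needs. *)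
Lemma fp_states X `{Enc X} (v1 v2 : X -> seq fracn) (f : X -> seq (seq fracn))
    (M : X -> seq unit) (S R : X -> fracn) :
  fp v1 -> fp v2 -> fp f -> fp M -> fp S -> fp R ->
  fp (fun x => states (v1 x) (v2 x) (f x) (M x) (S x) (R x)).
Proof.
move=> Hv1 Hv2 Hf HM HS HR; rewrite /states.
have Hl := fp_cat Hv1 Hv2.
pose h x := size (v1 x ++ v2 x); pose N x := h x * size (M x).
have hb : pbound h by exact: pbound_size.
have Nb : pbound N by apply: pbound_mul hb (pbound_size HM).
apply: (fp_foldl_bound (m := fun x => ((h x).+1 * ((N x).+1 * (N x).+1)) *
    (2 * (4 * (h x * (2 * h x).+1) + 3 * N x + 3)).+1) _ _ Hl).
- by apply: fp_next_states; fp_go.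
- by fp_go.
- apply: pbound_mul.
    by apply: pbound_mul (pbound_S hb) _; apply: pbound_mul; apply: pbound_S.
  apply: pbound_S; apply: pbound_mul (pbound_const _) _.
  apply: pbound_add (pbound_const _); apply: pbound_add; apply: pbound_mul => //; try exact: pbound_const.
  by apply: pbound_mul => //; apply: pbound_S; apply: pbound_mul => //; exact: pbound_const.
move=> x l1 l2 lE.
have l1h : size l1 <= h x by rewrite /h lE size_cat leq_addr.
have [bd un] := states_prefix (v1 x) (v2 x) (f x) (M x) (S x) (R x) l1.
apply: leq_trans (size_enc_seq_le (k := 4 * (h x * (2 * h x).+1) + 3 * N x + 3) _) _.
  move=> s sl; apply: leq_trans (size_enc_bounded (allP bd s _)) _.
    elim: (foldl _ _ _) sl => //= t r IH [->|/IH]; rewrite inE ?eqxx // => ->.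
    by rewrite orbT.
  have -> : size (v1 x) + size (v2 x) = h x by rewrite /h size_cat.
  by rewrite leq_add2r leq_add // leq_mul2l /= leq_mul.
rewrite leq_mul //; apply: leq_trans (size_bounded bd un) _.
by rewrite !leq_mul // ltnS leq_mul.
Qed.

Lemma fp_tables X `{Enc X} (pad : X -> seq unit) (v1 v2 : X -> seq fracn)
    (f : X -> seq (seq fracn)) : fp pad -> fp v1 -> fp v2 -> fp f ->
  fp (fun x => tables (pad x) (v1 x) (v2 x) (f x)).
Proof.
move=> Hp Hv1 Hv2 Hf; rewrite /tables.
apply: fp_flatten; apply: fp_map; last exact: fp_weights.
apply: fp_flatten; apply: fp_map; last by apply: fp_weights; fp_go.
apply: fp_map; first by apply: fp_table_of; fp_go.
by apply: fp_states; fp_go.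
Qed.

(** * Correctness of the algorithm *)

Section FracValue.
Local Open Scope ring_scope.

Definition fv (x : fracn) : rat := x.1%:R / x.2%:R.
Definition fpos (x : fracn) : bool := (0 < x.2)%N.

Lemma fpos_neq0 x : fpos x -> x.2%:R != 0 :> rat.
Proof. by rewrite pnatr_eq0 -lt0n. Qed.

Lemma fv_ge0 x : 0 <= fv x.
Proof. by rewrite divr_ge0 ?ler0n. Qed.

Lemma fv_add x y : fpos x -> fpos y -> fv (fadd x y) = fv x + fv y.
Proof.
move=> /fpos_neq0 px /fpos_neq0 py; rewrite /fv /fadd /= natrD !natrM.
by field; rewrite px py.
Qed.

Lemma fv_mul x y : fv (fmul x y) = fv x * fv y.
Proof. by rewrite /fv /fmul /= !natrM invfM mulrACA. Qed.

Lemma fleE x y : fpos x -> fpos y -> fle x y = (fv x <= fv y).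
Proof.
move=> px py; rewrite /fv ler_pdivrMr ?ltr0n // mulrAC ler_pdivlMr ?ltr0n //.
by rewrite -!natrM ler_nat.
Qed.

Lemma fpos_fmul x y : fpos x -> fpos y -> fpos (fmul x y).
Proof. by rewrite /fpos muln_gt0 => -> ->. Qed.

Lemma fsum_value (l : seq fracn) : all fpos l ->
  fpos (fsum l) /\ fv (fsum l) = \sum_(x <- l) fv x.
Proof.
elim/last_ind: l => [|l x IH]; first by rewrite big_nil /fv mul0r.
rewrite all_rcons => /andP[px /IH[pl e]].
rewrite /fsum foldl_rcons -/(fsum l) fv_add // -cats1 big_cat big_seq1 e.
by split=> //; rewrite /fpos muln_gt0; apply/andP.
Qed.

Lemma fpos_nth l i : all fpos l -> fpos (nth frac0 l i).
Proof.
move=> pl; case: (ltnP i (size l)) => h; last by rewrite nth_default.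
exact: (allP pl _ (mem_nth _ h)).
Qed.

Lemma sum_indices (l : seq fracn) (F : nat -> rat) :
  \sum_(i <- indices l) F i = \sum_(i < size l) F i.
Proof. by rewrite /indices -{1}[size l]subn0 big_mkord. Qed.

Lemma line_weight_value v col a : all fpos v -> all fpos col ->
  [/\ fpos (line_weight v col a).1, fpos (line_weight v col a).2,
      fv (line_weight v col a).1 =
        \sum_(i < size v) (if (a <= i)%N then fv (nth frac0 col i) * fv (nth frac0 v i) else 0) &
      fv (line_weight v col a).2 =
        fv (nth frac0 v a) * \sum_(i < size v) (if (a <= i)%N then fv (nth frac0 col i) else 0)].
Proof.
move=> pv pc.
have f00 : fv frac0 = 0 by rewrite /fv mul0r.
have [|p1 e1] := @fsum_value [seq if (a <= i)%N then fmul (nth frac0 col i) (nth frac0 v i)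
    else frac0 | i <- indices v].
  by apply/allP => _ /mapP[i _ ->]; case: ifP => // _; rewrite fpos_fmul ?fpos_nth.
have [|p2 e2] := @fsum_value [seq if (a <= i)%N then nth frac0 col i else frac0
    | i <- indices v].
  by apply/allP => _ /mapP[i _ ->]; case: ifP => // _; rewrite fpos_nth.
rewrite /line_weight /= fpos_fmul ?fpos_nth // fv_mul e1 e2 !big_map !sum_indices.
split=> //; [|congr (_ * _)]; apply: eq_bigr => i _.
  by case: ifP; rewrite ?fv_mul.
by case: ifP.
Qed.

(** The counter rises while the next multiple fits, and once it stalls it stalls for good. It ends
    at the true rounding or at the cap [size M], and the cap is harmless for [s] at most [S]. *)
Lemma round_to_value S M s : fpos S -> fpos s ->
  (round_to S M s)%:R * fv S <= (size M)%:R * fv s /\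
  (fle s S -> (size M)%:R * fv s <= (round_to S M s).+1%:R * fv S).
Proof.
move=> pS ps; set m := size M.
pose P c := fle (c * S.1, S.2)%N (m * s.1, s.2)%N.
have PE c : P c = (c%:R * fv S <= m%:R * fv s).
  by rewrite /P fleE // /fv /= !natrM !mulrA.
have [c0 cM] : ((round_to S M s == 0) || P (round_to S M s))%N /\
    ((round_to S M s == m) || ~~ P (round_to S M s).+1)%N.
  rewrite /m; apply: (@foldl_inv nat unit (fun k c => ((c == 0) || P c) /\
     ((c == k) || ~~ P c.+1))%N) => // k c _ [h1 h2].
  case: ifP => hP; first by rewrite -[fle _ _]/(P c.+1) in hP; rewrite hP;
    move: h2; rewrite hP orbF eqSS => ->; rewrite orbT.
  by rewrite -[fle _ _]/(P c.+1) in hP; rewrite hP orbT.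
split; first by case/predU1P: c0 => [->|]; rewrite ?PE // mul0r mulr_ge0 ?ler0n ?fv_ge0.
rewrite fleE // => sS; case/predU1P: cM => [->|].
  apply: le_trans (ler_wpM2l (ler0n _ _) sS) _.
  by rewrite ler_wpM2r ?fv_ge0 // ler_nat.
by rewrite PE -ltNge => /ltW.
Qed.

End FracValue.

Lemma find_iota_le (p : nat -> bool) n i : (forall k l, k <= l < n -> p k -> p l) -> i < n ->
  (find p (iota 0 n) <= i) = p i.
Proof.
move=> up lt; apply/idP/idP => [le|pi].
  have fn : find p (iota 0 n) < n := leq_ltn_trans le lt.
  apply: up (_ : find p (iota 0 n) <= i < n) _; first by rewrite le.
  have hs : has p (iota 0 n) by rewrite has_find size_iota.
  by have := nth_find 0 hs; rewrite nth_iota.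
rewrite leqNgt; apply/negP => /(before_find 0).
by rewrite nth_iota // pi.
Qed.

Lemma find_threshold (p : nat -> bool) n a : (forall k, k < n -> p k = (a <= k)) -> a < n ->
  find p (iota 0 n) = a.
Proof.
move=> pE an; apply/eqP; rewrite eqn_leq; apply/andP; split.
  rewrite find_iota_le ?pE // => k l /andP[kl ln].
  by rewrite !pE // ?(leq_ltn_trans kl ln) // => /leq_trans; apply.
rewrite leqNgt; apply/negP => lt.
have up k l : k <= l < n -> p k -> p l.
  by case/andP=> kl ln; rewrite !pE // ?(leq_ltn_trans kl ln) // => /leq_trans; apply.
have := find_iota_le up (ltn_trans lt an); rewrite leqnn pE ?(ltn_trans lt an) //.
by rewrite leqNgt lt.
Qed.

(** * Welfare and revenue in terms of thresholds *)

Section Mechanisms.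
Local Open Scope ring_scope.
Variable I : instance.

(* [a j] and [b i] are the least winning value indices of bidder 1 in column [j] and of
   bidder 2 in row [i]; a value past the end of the table means "never". *)
Definition thresholds (A : mech) (a b : nat -> nat) : Prop :=
  forall i j, (i < h1 I)%N -> (j < h2 I)%N ->
    A_at A i j = (if a j <= i then 1 else if b i <= j then 2 else 0)%N /\
    ~~ ((a j <= i) && (b i <= j))%N.

Definition col_weight (j a : nat) : rat * rat :=
  (\sum_(i < h1 I) (if (a <= i)%N then f_at I i j * nth 0 (Defs.val1 I) i else 0),
   nth 0 (Defs.val1 I) a * \sum_(i < h1 I) (if (a <= i)%N then f_at I i j else 0)).

Definition row_weight (i b : nat) : rat * rat :=
  (\sum_(j < h2 I) (if (b <= j)%N then f_at I i j * nth 0 (Defs.val2 I) j else 0),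
   nth 0 (Defs.val2 I) b * \sum_(j < h2 I) (if (b <= j)%N then f_at I i j else 0)).

Variables (A : mech) (a b : nat -> nat).
Hypothesis thr : thresholds A a b.

Lemma SW_thresholds : SW I A =
  \sum_(j < h2 I) (col_weight j (a j)).1 + \sum_(i < h1 I) (row_weight i (b i)).1.
Proof.
rewrite /SW /col_weight /row_weight /= [X in _ = X + _]exchange_big -big_split /=.
apply: eq_bigr => i _.
rewrite -big_split; apply: eq_bigr => j _ /=.
have [e d] := thr (ltn_ord i) (ltn_ord j); rewrite /winner_value e.
move: d {e}; case: (a j <= i)%N; case: (b i <= j)%N => //= _;
  by rewrite ?mulr0 ?addr0 ?add0r.
Qed.

(** The critical value found by [find] is the threshold of the line, the same for all cells won in
    it. By disjointness at most one summand is present. *)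
Lemma payment_thresholds i j : (i < h1 I)%N -> (j < h2 I)%N ->
  payment I A i j = (if (a j <= i)%N then nth 0 (Defs.val1 I) (a j) else 0) +
                    (if (b i <= j)%N then nth 0 (Defs.val2 I) (b i) else 0).
Proof.
move=> ih jh; have [e d] := thr ih jh; rewrite /payment e.
move: d {e}; case aj: (a j <= i)%N; case bi: (b i <= j)%N => //= _; rewrite ?addr0 ?add0r //.
- congr nth; apply: find_threshold; last exact: leq_ltn_trans aj ih.
  by move=> k kh; have [-> _] := thr kh jh; case: (a j <= k)%N => //; case: (b k <= j)%N.
- congr nth; apply: find_threshold; last exact: leq_ltn_trans bi jh.
  move=> k kh; have [-> d'] := thr ih kh.
  move: d'; case: (a k <= i)%N => //= [/negPf->|_] //; by case: (b i <= k)%N.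
Qed.

Lemma Rev_thresholds : Rev I A =
  \sum_(j < h2 I) (col_weight j (a j)).2 + \sum_(i < h1 I) (row_weight i (b i)).2.
Proof.
rewrite /Rev /col_weight /row_weight /=.
under [X in X + _]eq_bigr do rewrite mulr_sumr.
under [X in _ + X]eq_bigr do rewrite mulr_sumr.
rewrite [X in _ = X + _]exchange_big -big_split /=; apply: eq_bigr => i _.
rewrite -big_split; apply: eq_bigr => j _ /=.
rewrite payment_thresholds // mulrDr.
by congr (_ + _); case: ifP; rewrite ?mulr0 // mulrC.
Qed.

Lemma thresholds_mechanism : size A = h1 I -> all (fun row => size row == h2 I) A ->
  is_mechanism I A.
Proof.
move=> sA srow; split=> //.
- by move=> i j ih jh; have [-> _] := thr ih jh; case: (a j <= i)%N => //; case: (b i <= j)%N.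
- move=> i j k /andP[ik kh] jh; have [-> _] := thr (leq_ltn_trans ik kh) jh.
  have [-> _] := thr kh jh; case aj: (a j <= i)%N; last by case: (b i <= j)%N.
  by rewrite (leq_trans aj ik).
- move=> i j k ih /andP[jk kh]; have [-> _] := thr ih (leq_ltn_trans jk kh).
  have [-> d] := thr ih kh; case: (a j <= i)%N => //; case bj: (b i <= j)%N => // _.
  by move: d; rewrite (leq_trans bj jk) andbT => /negPf->.
Qed.

End Mechanisms.

(** [find] returns the length of the range when the bidder never wins in the line, in accordance
    with the convention for thresholds; monotonicity makes the winning set everything from there
    on. *)
Lemma mechanism_thresholds I B : is_mechanism I B ->
  exists a b, [/\ thresholds I B a b, forall j, a j <= h1 I & forall i, b i <= h2 I].
Proof.
case=> _ _ B2 mono1 mono2.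
exists (fun j => find (fun k => A_at B k j == 1) (iota 0 (h1 I))).
exists (fun i => find (fun k => A_at B i k == 2) (iota 0 (h2 I))).
split=> [i j ih jh|j|i]; [|by rewrite -{2}[h1 I](size_iota 0) find_size
                         |by rewrite -{2}[h2 I](size_iota 0) find_size].
rewrite !find_iota_le //.
- by have := B2 i j ih jh; case: (A_at B i j) => [|[|[|]]].
- by move=> k l kl /eqP Bk; apply/eqP; apply: mono2 Bk.
- by move=> k l kl /eqP Bk; apply/eqP; apply: mono1 Bk.
Qed.

Definition thr_at (l : seq nat) (j : nat) : nat := nth 0 (rev l) j.

Lemma thr_at_cons_lt a l j : j < size l -> thr_at (a :: l) j = thr_at l j.
Proof. by move=> lt; rewrite /thr_at rev_cons nth_rcons size_rev lt. Qed.

Lemma thr_at_cons_eq a l : thr_at (a :: l) (size l) = a.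
Proof. by rewrite /thr_at rev_cons nth_rcons size_rev ltnn eqxx. Qed.

Lemma sum_thr_at_cons (F : nat -> nat -> nat) a l :
  \sum_(j < size (a :: l)) F j (thr_at (a :: l) j) = \sum_(j < size l) F j (thr_at l j) + F (size l) a.
Proof.
rewrite /= big_ord_recr /= thr_at_cons_eq; congr (_ + _).
by apply: eq_bigr => j _; rewrite thr_at_cons_lt.
Qed.

(** * The search follows exactly the lattice paths *)

Section Paths.
Variables (v1 v2 : seq fracn) (f : seq (seq fracn)) (M : seq unit) (S R : fracn).

Definition col_line j a := line_weight v1 (column f j) a.
Definition row_line i b := line_weight v2 (nth [::] f i) b.

Definition sound k (s : state) : Prop :=
  [/\ size s.1 <= size v2 /\ size s.2.1 <= size v1, size s.1 + size s.2.1 = k,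
    forall i j, j < size s.1 -> i < size s.2.1 ->
      ~~ ((thr_at s.1 j <= i) && (thr_at s.2.1 i <= j)),
    s.2.2.1 = \sum_(j < size s.1) round_to S M (col_line j (thr_at s.1 j)).1 +
              \sum_(i < size s.2.1) round_to S M (row_line i (thr_at s.2.1 i)).1 &
    s.2.2.2 = \sum_(j < size s.1) round_to R M (col_line j (thr_at s.1 j)).2 +
              \sum_(i < size s.2.1) round_to R M (row_line i (thr_at s.2.1 i)).2].

(** Conflicts can arise only where the new line meets lines already crossed. Its threshold lies at
    or beyond all of them, so it claims none of these cells. *)
Lemma sound_expand k s t : sound k s -> t \in expand v1 v2 f M S R s -> sound k.+1 t.
Proof.
case: s => al [bl [x y]] [/= [sa sb] sk disj xE yE] /mapP[c].
rewrite mem_filter => /andP[_] /candidatesP /= [] [a [lt /andP[le _] ->]] ->.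
- split=> //=; first by rewrite addSn sk.
  + move=> i j; rewrite ltnS leq_eqVlt => /predU1P[->|jl] il.
      by rewrite thr_at_cons_eq leqNgt (leq_trans il le).
    by rewrite thr_at_cons_lt //; apply: disj.
  + rewrite xE -[(size al).+1]/(size (a :: al)).
    by rewrite (sum_thr_at_cons (fun j a => round_to S M (col_line j a).1)) addnAC.
  + rewrite yE -[(size al).+1]/(size (a :: al)).
    by rewrite (sum_thr_at_cons (fun j a => round_to R M (col_line j a).2)) addnAC.
- split=> //=; first by rewrite addnS sk.
  + move=> i j jl; rewrite ltnS leq_eqVlt => /predU1P[->|il].
      by rewrite thr_at_cons_eq andbC leqNgt (leq_trans jl le).
    by rewrite thr_at_cons_lt //; apply: disj.
  + rewrite xE -[(size bl).+1]/(size (a :: bl)).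
    by rewrite (sum_thr_at_cons (fun j a => round_to S M (row_line j a).1)) addnA.
  + rewrite yE -[(size bl).+1]/(size (a :: bl)).
    by rewrite (sum_thr_at_cons (fun j a => round_to R M (row_line j a).2)) addnA.
Qed.

Lemma states_sound s : s \in states v1 v2 f M S R -> sound (size v1 + size v2) s.
Proof.
move: s; rewrite -size_cat /states.
apply: (@foldl_inv (seq state) fracn (fun k l => forall s, s \in l -> sound k s)).
  move=> k l _ IH s /dedup_sub/flatten_mapP[t tl]; apply: sound_expand; exact: IH.
by move=> s; rewrite inE => /eqP->; split; rewrite /= ?big_ord0.
Qed.

Variables a b : nat -> nat.
Hypothesis a_le : forall j, a j <= size v1.
Hypothesis b_le : forall i, b i <= size v2.
Hypothesis disjoint : forall i j, i < size v1 -> j < size v2 -> ~~ ((a j <= i) && (b i <= j)).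
Hypothesis a_below : forall j, j < size v2 -> below S R (col_line j (a j)).
Hypothesis b_below : forall i, i < size v1 -> below S R (row_line i (b i)).

Definition rounded_sum i g : nat * nat :=
  (\sum_(j < g) round_to S M (col_line j (a j)).1 + \sum_(i' < i) round_to S M (row_line i' (b i')).1,
   \sum_(j < g) round_to R M (col_line j (a j)).2 + \sum_(i' < i) round_to R M (row_line i' (b i')).2).

(* The lattice path followed by the thresholds [a], [b] passes through (i, g) after k steps. *)
Definition reached k (l : seq state) : Prop :=
  exists i g, [/\ i + g = k, i <= size v1 /\ g <= size v2,
    forall j, g <= j < size v2 -> i <= a j,
    forall i', i <= i' < size v1 -> g <= b i' &
    exists s, [/\ s \in l, size s.1 = g & key s = (i, rounded_sum i g)]].

Lemma next_states_key (l : seq state) s t : s \in l -> t \in expand v1 v2 f M S R s ->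
  exists2 u, u \in next_states v1 v2 f M S R l & key u = key t.
Proof. by move=> sl ts; apply: dedup_key; apply/flatten_mapP; exists s. Qed.

(** The representative [s] may have other thresholds behind it than the path of [a] and [b].
    Crossing column [g] at [a g] adds the same rounded weights to it, so its key remains that of the
    path. *)
Lemma reached_col k l i g s : (forall s, s \in next_states v1 v2 f M S R l -> sound k.+1 s) ->
  i + g = k -> i <= size v1 -> g < size v2 ->
  (forall j, g <= j < size v2 -> i <= a j) ->
  (forall i', i <= i' < size v1 -> g < b i') ->
  s \in l -> size s.1 = g -> key s = (i, rounded_sum i g) ->
  reached k.+1 (next_states v1 v2 f M S R l).
Proof.
move=> snd ik ih gh ha hb sl sg [si sx sy].
have [|u ul ku] := next_states_key (t := (a g :: s.1, (s.2.1,
    (s.2.2.1 + round_to S M (col_line g (a g)).1, s.2.2.2 + round_to R M (col_line g (a g)).2)))) sl.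
  apply/mapP; exists (a g :: s.1, (s.2.1, col_line g (a g))) => //.
  rewrite mem_filter a_below //=; apply/candidatesP; left; exists (a g).
  by rewrite sg si gh a_le ha // leqnn.
exists i, g.+1; split=> //; first by rewrite addnS ik.
  by move=> j /andP[gj jh]; apply: ha; rewrite (ltnW gj).
exists u; split=> //.
  (* Soundness gives the total number of crossed lines and the key the number of rows, hence that of
     columns. *)
  have [_ su _ _ _] := snd _ ul; case: ku => /= e _ _; move: su si ik e; clear; lia.
by rewrite ku /key /= si sx sy /rounded_sum !big_ord_recr /= ![_ + _ + round_to _ _ _]addnAC.
Qed.

Lemma reached_row k l i g s : (forall s, s \in next_states v1 v2 f M S R l -> sound k.+1 s) ->
  i + g = k -> i < size v1 -> g <= size v2 ->
  (forall j, g <= j < size v2 -> i < a j) ->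
  (forall i', i <= i' < size v1 -> g <= b i') ->
  s \in l -> size s.1 = g -> key s = (i, rounded_sum i g) ->
  reached k.+1 (next_states v1 v2 f M S R l).
Proof.
move=> snd ik ih gh ha hb sl sg [si sx sy].
have [|u ul ku] := next_states_key (t := (s.1, (b i :: s.2.1,
    (s.2.2.1 + round_to S M (row_line i (b i)).1, s.2.2.2 + round_to R M (row_line i (b i)).2)))) sl.
  apply/mapP; exists (s.1, (b i :: s.2.1, row_line i (b i))) => //.
  rewrite mem_filter b_below //=; apply/candidatesP; right; exists (b i).
  by rewrite sg si ih b_le hb // leqnn.
exists i.+1, g; split=> //; first by rewrite addSn ik.
  by move=> j /andP[ij jh]; apply: hb; rewrite (ltnW ij).
exists u; split=> //.
  have [_ su _ _ _] := snd _ ul; case: ku => /= e _ _; move: su si ik e; clear; lia.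
by rewrite ku /key /= si sx sy /rounded_sum !big_ord_recr /= !addnA.
Qed.

(** Row [i] can be crossed when all remaining columns have thresholds above [i]. Otherwise some
    column [j >= g] is won by bidder 1 from row [i] on; by disjointness every remaining [b i']
    exceeds [j], so column [g] can be crossed. *)
Lemma reached_next k l : (forall s, s \in next_states v1 v2 f M S R l -> sound k.+1 s) ->
  k < size v1 + size v2 -> reached k l -> reached k.+1 (next_states v1 v2 f M S R l).
Proof.
move=> snd kh [i [g [ik [ih gh] ha hb [s [sl sg ks]]]]].
case: (ltnP i (size v1)) => i1; last first.
  apply: (reached_col snd ik ih _ ha _ sl sg ks); first by lia.
  by move=> i' /andP[]; lia.
case: (ltnP g (size v2)) => g1; last first.
  apply: (reached_row snd ik i1 gh _ hb sl sg ks).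
  by move=> j /andP[]; lia.
case: (boolP [forall j : 'I_(size v2), (g <= j) ==> (i < a j)]) => [/forallP hj|].
  apply: (reached_row snd ik i1 gh _ hb sl sg ks) => j /andP[gj jh].
  exact: (implyP (hj (Ordinal jh))).
rewrite negb_forall => /existsP[j]; rewrite negb_imply -leqNgt => /andP[gj aj].
apply: (reached_col snd ik ih g1 ha _ sl sg ks) => i' /andP[ii' i'h].
have := disjoint i'h (ltn_ord j); rewrite (leq_trans aj ii') /= -ltnNge.
exact: leq_trans.
Qed.

Lemma states_complete : exists s, [/\ s \in states v1 v2 f M S R, size s.1 = size v2 &
  key s = (size v1, rounded_sum (size v1) (size v2))].
Proof.
have : size v1 + size v2 <= size v1 + size v2 ->
    (forall s, s \in states v1 v2 f M S R -> sound (size v1 + size v2) s) /\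
    reached (size v1 + size v2) (states v1 v2 f M S R).
  rewrite -{1 3 4}size_cat /states.
  apply: (@foldl_inv (seq state) fracn (fun k l => k <= size v1 + size v2 ->
    (forall s, s \in l -> sound k s) /\ reached k l)).
    move=> k l _ IH lt; have [snd re] := IH (ltnW lt).
    have snd' s : s \in next_states v1 v2 f M S R l -> sound k.+1 s.
      by move=> /dedup_sub/flatten_mapP[t tl]; apply: sound_expand; apply: snd.
    by split=> //; apply: reached_next.
  move=> _; split=> [s|]; first by rewrite inE => /eqP->; split; rewrite /= ?big_ord0.
  exists 0, 0; split=> //.
  by exists ([::], ([::], (0, 0))); rewrite mem_head /rounded_sum /key /= !big_ord0.
case=> // _ [i [g [ig [ih gh] _ _ [s [sl sg ks]]]]].
have iE : i = size v1 by lia.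
have gE : g = size v2 by lia.
by exists s; rewrite -gE -iE.
Qed.

End Paths.

(** * From equal rounded totals to the approximation ratio *)

Section Approximation.
Local Open Scope ring_scope.

Lemma seq_max (T : eqType) (F : T -> rat) (l : seq T) : l != [::] ->
  exists2 w, w \in l & forall w', w' \in l -> F w' <= F w.
Proof.
elim: l => // x [|y l] IH _; first by exists x; rewrite ?mem_head // => w; rewrite inE => /eqP->.
have [//|w wl wmax] := IH.
case: (leP (F x) (F w)) => xw.
  exists w; first by rewrite inE wl orbT.
  by move=> w'; rewrite inE => /predU1P[->|/wmax].
exists x; first exact: mem_head.
move=> w'; rewrite inE => /predU1P[->|/wmax] // le; exact: le_trans le (ltW xw).
Qed.

Lemma round_sum_lower S M (l : seq fracn) : fpos S -> all fpos l ->
  (\sum_(x <- l) round_to S M x)%N%:R * fv S <= (size M)%:R * \sum_(x <- l) fv x.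
Proof.
move=> pS pl; rewrite natr_sum mulr_suml mulr_sumr big_seq [X in _ <= X]big_seq.
by apply: ler_sum => x /(allP pl) px; have [] := round_to_value M pS px.
Qed.

Lemma round_sum_upper S M (l : seq fracn) : fpos S -> all fpos l -> all (fle^~ S) l ->
  (size M)%:R * \sum_(x <- l) fv x <= (\sum_(x <- l) round_to S M x + size l)%N%:R * fv S.
Proof.
move=> pS pl ls; rewrite -(sum1_size l) -big_split /= natr_sum mulr_suml mulr_sumr.
rewrite big_seq [X in _ <= X]big_seq.
apply: ler_sum => x xl; rewrite addn1; have [_] := round_to_value M pS (allP pl _ xl).
by apply; exact: (allP ls).
Qed.

(** [r] is the rounded total common to both mechanisms. The last two hypotheses give xA >= xB - S /
    K, which is at least (1 - 1 / K) xB because S <= xB. *)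
Lemma approx (n K r : nat) (eps S xA xB : rat) : (0 < n)%N -> 0 < eps -> 1 + eps^-1 <= K%:R ->
  0 <= xB -> S <= xB -> (n * K)%:R * xB <= (r + n)%N%:R * S -> r%:R * S <= (n * K)%:R * xA ->
  xB / (1 + eps) <= xA.
Proof.
move=> n0 e0 Kge xB0 SxB up lo.
have e1 : 0 < 1 + eps by lra.
have K0 : 0 < K%:R :> rat by apply: lt_le_trans Kge; rewrite ltr_wpDr ?invr_ge0 ?ltr01 // ltW.
have n0' : 0 < n%:R :> rat by rewrite ltr0n.
have h1 : K%:R * xB <= K%:R * xA + xB.
  rewrite -(ler_pM2l n0') mulrDr; move: up lo; rewrite natrD !natrM.
  have := ler_wpM2l (ltW n0') SxB; lra.
have h2 : 1 + eps <= K%:R * eps.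
  have := ler_wpM2r (ltW e0) Kge; rewrite mulrDl mul1r mulVf ?gt_eqF //; lra.
rewrite ler_pdivrMr // -(ler_pM2l K0).
have := ler_wpM2r xB0 h2; have := ler_wpM2r (ltW e1) h1; lra.
Qed.

End Approximation.

Definition fraction_of (q : rat) : fracn := (`|numq q|%N, `|denq q|%N).

Lemma fpos_fraction_of q : fpos (fraction_of q).
Proof. by rewrite /fpos absz_gt0 denq_neq0. Qed.

Lemma fv_fraction_of q : (0 <= q)%R -> fv (fraction_of q) = q.
Proof.
move=> q0; rewrite /fv /fraction_of /= -[RHS]divq_num_den.
by rewrite !natr_absz !ger0_norm ?numq_ge0 ?denq_ge0.
Qed.

Lemma all_fpos_fractions (l : seq rat) : all fpos (map fraction_of l).
Proof. by apply/allP => _ /mapP[q _ ->]; apply: fpos_fraction_of. Qed.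

(** * The tables found form an eps-Pareto set *)

Section Pareto.
Local Open Scope ring_scope.
Variables (I : instance) (eps : rat) (pad : seq unit).
Hypotheses (wfI : wf_instance I) (eps_gt0 : 0 < eps) (pad_ge : 1 + eps^-1 <= (size pad)%:R).

Let v1 := map fraction_of (Defs.val1 I).
Let v2 := map fraction_of (Defs.val2 I).
Let f := map (map fraction_of) (pmf I).

Lemma size_v1 : size v1 = h1 I. Proof. exact: size_map. Qed.
Lemma size_v2 : size v2 = h2 I. Proof. exact: size_map. Qed.

Lemma size_f : size f = h1 I.
Proof. by rewrite size_map; case: wfI => _ _ _ []. Qed.

Lemma fv_nth (l : seq rat) i : all (fun x => 0 <= x) l ->
  fv (nth frac0 (map fraction_of l) i) = nth 0 l i.
Proof.
move=> l0; case: (ltnP i (size l)) => h.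
  by rewrite (nth_map 0) // fv_fraction_of // (allP l0) ?mem_nth.
(* Past the end both defaults are zero; this is the price attached to a line in which the bidder
   never wins. *)
by rewrite !nth_default ?size_map // /fv mul0r.
Qed.

Lemma fv_table i j : (i < h1 I)%N -> (j < h2 I)%N ->
  fv (nth frac0 (nth [::] f i) j) = f_at I i j.
Proof.
case: wfI => _ _ _ [sp /allP rows] [f0 _] ih jh.
have ip : (i < size (pmf I))%N by rewrite sp.
have jp : (j < size (nth [::] (pmf I) i))%N by rewrite (eqP (rows _ (mem_nth _ ip))).
by rewrite (nth_map [::]) // (nth_map 0) // fv_fraction_of //; exact: f0.
Qed.

Lemma all_fpos_row i : all fpos (nth [::] f i).
Proof.
case: (ltnP i (size (pmf I))) => h; last by rewrite nth_default ?size_map.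
by rewrite (nth_map [::]) //; apply: all_fpos_fractions.
Qed.

Lemma all_fpos_column j : all fpos (column f j).
Proof.
apply/allP => _ /mapP[row /(nthP [::])[i _ <-] ->].
exact/fpos_nth/all_fpos_row.
Qed.

Lemma col_line_value j a : (j < h2 I)%N ->
  [/\ fpos (col_line v1 f j a).1, fpos (col_line v1 f j a).2,
      fv (col_line v1 f j a).1 = (col_weight I j a).1 & fv (col_line v1 f j a).2 = (col_weight I j a).2].
Proof.
move=> jh; have [_ _ [val1_ge0 _] _ _] := wfI.
have [p1 p2 e1 e2] := line_weight_value a (all_fpos_fractions (Defs.val1 I)) (all_fpos_column j).
split=> //; rewrite ?e1 ?e2 ?fv_nth // size_v1 /col_weight /=; [|congr (_ * _)];
  apply: eq_bigr => i _; case: ifP => // _;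
  by rewrite ?fv_nth // (nth_map [::]) ?size_f // fv_table.
Qed.

Lemma row_line_value i b : (i < h1 I)%N ->
  [/\ fpos (row_line v2 f i b).1, fpos (row_line v2 f i b).2,
      fv (row_line v2 f i b).1 = (row_weight I i b).1 & fv (row_line v2 f i b).2 = (row_weight I i b).2].
Proof.
move=> ih; have [_ _ [_ val2_ge0] _ _] := wfI.
have [p1 p2 e1 e2] := line_weight_value b (all_fpos_fractions (Defs.val2 I)) (all_fpos_row i).
split=> //; rewrite ?e1 ?e2 ?fv_nth // size_v2 /row_weight /=; [|congr (_ * _)];
  apply: eq_bigr => j _; case: ifP => // _;
  by rewrite ?fv_nth // fv_table.
Qed.

Definition edges (a b : nat -> nat) : seq (fracn * fracn) :=
  [seq col_line v1 f j (a j) | j <- iota 0 (h2 I)] ++ [seq row_line v2 f i (b i) | i <- iota 0 (h1 I)].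

Lemma size_edges a b : size (edges a b) = (h1 I + h2 I)%N.
Proof. by rewrite size_cat !size_map !size_iota addnC. Qed.

Lemma edges_fpos a b : all (fun w => fpos w.1 && fpos w.2) (edges a b).
Proof.
apply/allP => w; rewrite mem_cat => /orP[] /mapP[i]; rewrite mem_iota => /= ih ->.
  by have [-> ->] := col_line_value (a i) ih.
by have [-> ->] := row_line_value (b i) ih.
Qed.

Lemma sum_edges (V : nmodType) (F : fracn * fracn -> V) a b :
  \sum_(w <- edges a b) F w =
  \sum_(j < h2 I) F (col_line v1 f j (a j)) + \sum_(i < h1 I) F (row_line v2 f i (b i)).
Proof.
by rewrite big_cat !big_map -[h2 I in LHS]subn0 -[h1 I in LHS]subn0 !big_mkord.
Qed.

Lemma SW_edges A a b : thresholds I A a b -> SW I A = \sum_(w <- edges a b) fv w.1.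
Proof.
move=> thr; rewrite (SW_thresholds thr) (sum_edges (fun w => fv w.1)).
congr (_ + _); apply: eq_bigr => i _; first by have [_ _ ->] := col_line_value (a i) (ltn_ord i).
by have [_ _ ->] := row_line_value (b i) (ltn_ord i).
Qed.

Lemma Rev_edges A a b : thresholds I A a b -> Rev I A = \sum_(w <- edges a b) fv w.2.
Proof.
move=> thr; rewrite (Rev_thresholds thr) (sum_edges (fun w => fv w.2)).
congr (_ + _); apply: eq_bigr => i _; first by have [_ _ _ ->] := col_line_value (a i) (ltn_ord i).
by have [_ _ _ ->] := row_line_value (b i) (ltn_ord i).
Qed.

Lemma edges_weights a b : (forall j, (a j <= h1 I)%N) -> (forall i, (b i <= h2 I)%N) ->
  {subset edges a b <= weights v1 v2 f}.
Proof.
move=> ha hb w; rewrite !mem_cat => /orP[] /mapP[i]; rewrite mem_iota add0n => ih ->; apply/orP.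
  left; apply/flatten_mapP; exists i; first by rewrite mem_indices size_v2.
  by apply/mapP; exists (a i) => //; rewrite mem_indices /= size_v1 ltnS.
right; apply/flatten_mapP; exists i; first by rewrite mem_indices size_v1.
by apply/mapP; exists (b i) => //; rewrite mem_indices /= size_v2 ltnS.
Qed.

Lemma A_at_table s i j : (i < h1 I)%N -> (j < h2 I)%N -> A_at (table_of v1 v2 s) i j =
  (if thr_at s.1 j <= i then 1 else if thr_at s.2.1 i <= j then 2 else 0)%N.
Proof.
move=> ih jh; rewrite /A_at /table_of /indices (nth_map 0%N) ?size_iota ?size_v1 //.
by rewrite (nth_map 0%N) ?size_iota ?size_v2 // !nth_iota ?size_v1 ?size_v2.
Qed.

Lemma sound_thresholds M S R s : sound v1 v2 f M S R (h1 I + h2 I) s ->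
  [/\ size s.1 = h2 I, size s.2.1 = h1 I &
      thresholds I (table_of v1 v2 s) (thr_at s.1) (thr_at s.2.1)].
Proof.
case=> -[s1 s2] sk disj _ _; rewrite size_v1 in s2; rewrite size_v2 in s1.
have e1 : size s.1 = h2 I by lia.
have e2 : size s.2.1 = h1 I by lia.
by split=> // i j ih jh; rewrite A_at_table //; split=> //; apply: disj; rewrite ?e1 ?e2.
Qed.

Lemma table_mechanism s : thresholds I (table_of v1 v2 s) (thr_at s.1) (thr_at s.2.1) ->
  is_mechanism I (table_of v1 v2 s).
Proof.
move=> thr; apply: thresholds_mechanism thr _ _; first by rewrite size_map size_iota size_v1.
by apply/allP => _ /mapP[i _ ->]; rewrite size_map size_iota size_v2.
Qed.

Let M := flatten [seq pad | _ <- v1 ++ v2].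

Lemma size_M : size M = ((h1 I + h2 I) * size pad)%N.
Proof.
rewrite /M -size_v1 -size_v2 -size_cat; elim: (v1 ++ v2) => //= x l IH.
by rewrite size_cat IH mulSn.
Qed.

Lemma tables_pareto : eps_pareto_set I eps (tables pad v1 v2 f).
Proof.
split=> [A|B mB].
  case/flatten_mapP=> w _ /flatten_mapP[w' _] /mapP[s /states_sound ss ->].
  rewrite size_v1 size_v2 in ss.
  by apply: table_mechanism; have [] := sound_thresholds ss.
have [a [b [thrB ha hb]]] := mechanism_thresholds mB.
have E0 : edges a b != [::].
  by rewrite -size_eq0 size_edges; case: wfI => -[]; case: (h1 I).
(* The successful guesses are the largest welfare weight and the largest revenue weight on the path
   of [B]: every line of that path then passes [below]. *)
have [w wE wmax] := seq_max (fun w => fv w.1) E0.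
have [w' wE' wmax'] := seq_max (fun w => fv w.2) E0.
have /allP posE := edges_fpos a b.
have /andP[pS _] := posE _ wE; have /andP[_ pR] := posE _ wE'.
have belowE e : e \in edges a b -> below w.1 w'.2 e.
  move=> eE; have /andP[p1 p2] := posE _ eE.
  by rewrite /below !fleE // wmax ?wmax'.
have inE1 j : (j < size v2)%N -> col_line v1 f j (a j) \in edges a b.
  rewrite size_v2 => jh; rewrite mem_cat; apply/orP; left; apply/mapP; exists j => //.
  by rewrite mem_iota.
have inE2 i : (i < size v1)%N -> row_line v2 f i (b i) \in edges a b.
  rewrite size_v1 => jh; rewrite mem_cat; apply/orP; right; apply/mapP; exists i => //.
  by rewrite mem_iota.
have [||i j ih jh|j jh|i ih|s [sl _ ks]] :=
    @states_complete v1 v2 f M w.1 w'.2 a b.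
- by move=> j; rewrite size_v1.
- by move=> i; rewrite size_v2.
- by rewrite size_v1 in ih; rewrite size_v2 in jh; have [] := thrB _ _ ih jh.
- exact/belowE/inE1.
- exact/belowE/inE2.
have ss := states_sound sl; rewrite size_v1 size_v2 in ss ks.
have [e1 e2 thrA] := sound_thresholds ss.
exists (table_of v1 v2 s).
  apply/flatten_mapP; exists w; first exact: edges_weights wE.
  apply/flatten_mapP; exists w'; first exact: edges_weights wE'.
  by apply/mapP; exists s.
case: ks => _ sx sy; case: ss => _ _ _ sx' sy'.
have n0 : (0 < h1 I + h2 I)%N by rewrite -(size_edges a b) lt0n size_eq0.
rewrite /covers /point /= !(SW_edges thrA, SW_edges thrB, Rev_edges thrA, Rev_edges thrB).
have le_sum (F : fracn * fracn -> fracn) e : e \in edges a b ->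
    fv (F e) <= \sum_(w <- edges a b) fv (F w).
  by move=> eE; rewrite (big_rem e) //= lerDl sumr_ge0 // => i _; apply: fv_ge0.
have posF c d : all fpos [seq w.1 | w <- edges c d] /\ all fpos [seq w.2 | w <- edges c d].
  by rewrite !all_map; split; apply: sub_all (edges_fpos c d) => e /andP[].
have [[pA1 pA2] [pB1 pB2]] := (posF (thr_at s.1) (thr_at s.2.1), posF a b).
split.
(* The state [s] has the rounded totals of [B] by completeness, and by soundness they are also those
   of its own thresholds. The upper rounding bound is applied to [B], the lower one to the table of
   [s]. *)
- apply: (@approx (h1 I + h2 I) (size pad) s.2.2.1 _ (fv w.1)) => //.
  + by apply: sumr_ge0 => i _; apply: fv_ge0.
  + exact: le_sum.
  + have := round_sum_upper M pS pB1; rewrite !big_map size_map size_edges size_M.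
    rewrite (sum_edges (fun w0 => round_to w.1 M w0.1)) sx; apply.
    by rewrite all_map; apply/allP => e /belowE /andP[].
  + have := round_sum_lower M pS pA1; rewrite !big_map size_M.
    by rewrite (sum_edges (fun w0 => round_to w.1 M w0.1)) sx' e1 e2.
- apply: (@approx (h1 I + h2 I) (size pad) s.2.2.2 _ (fv w'.2)) => //.
  + by apply: sumr_ge0 => i _; apply: fv_ge0.
  + exact: le_sum.
  + have := round_sum_upper M pR pB2; rewrite !big_map size_map size_edges size_M.
    rewrite (sum_edges (fun w0 => round_to w'.2 M w0.2)) sy; apply.
    by rewrite all_map; apply/allP => e /belowE /andP[].
  + have := round_sum_lower M pR pA2; rewrite !big_map size_M.
    by rewrite (sum_edges (fun w0 => round_to w'.2 M w0.2)) sy' e1 e2.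
Qed.

End Pareto.

(** * The Turing machine *)

(* Mirrors [enc_rat]: sign and absolute value of the numerator, then of the denominator. *)
Notation raw_int := (nat * (nat * unit))%type.
Notation raw_rat := (raw_int * (raw_int * unit))%type.
Notation raw_input :=
  (seq raw_rat * (seq raw_rat * (seq (seq raw_rat) * (raw_rat * unit))))%type.

Definition raw_int_of (z : int) : raw_int := (nat_of_bool (z < 0)%R, (`|z|%N, tt)).
Definition raw_rat_of (q : rat) : raw_rat := (raw_int_of (numq q), (raw_int_of (denq q), tt)).
Definition raw_input_of (I : instance) (eps : rat) : raw_input :=
  (map raw_rat_of (Defs.val1 I), (map raw_rat_of (Defs.val2 I),
    (map (map raw_rat_of) (pmf I), (raw_rat_of eps, tt)))).

Lemma enc_list_cons w ws : enc_list (w :: ws) = enc_pair w (enc_list ws).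
Proof. by rewrite /enc_list /= -catA. Qed.

Lemma enc_list_map T U `{Enc U} (g : T -> seq Sym) (h : T -> U) (l : seq T) :
  (forall x, g x = enc (h x)) -> enc_list (map g l) = enc (map h l).
Proof. by move=> gh; elim: l => // x l IH; rewrite !map_cons enc_list_cons IH gh. Qed.

Lemma enc_rat_raw q : enc_rat q = enc (raw_rat_of q).
Proof. by rewrite /enc_rat /enc_int !enc_list_cons. Qed.

Lemma enc_input_raw I eps : enc_input I eps = enc (raw_input_of I eps).
Proof.
rewrite /enc_input !enc_list_cons enc_rat_raw.
rewrite !(enc_list_map _ enc_rat_raw) (@enc_list_map _ _ _ _ (map raw_rat_of)) //.
by move=> row; apply: enc_list_map enc_rat_raw.
Qed.

Lemma enc_output_enc P : enc_output P = enc P.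
Proof.
have id_map T (l : seq T) : l = map id l by rewrite map_id.
rewrite /enc_output {2}[P]id_map; apply: enc_list_map => A.
rewrite /enc_mech {2}[A]id_map; apply: enc_list_map => row.
by rewrite {2}[row]id_map; apply: enc_list_map.
Qed.

Definition fraction_of_raw (r : raw_rat) : fracn := (r.1.2.1, r.2.1.2.1).

(** The padding loop supplies a length at least 1 / eps; the additional [tt] raises it to the
    required 1 + 1 / eps. *)
Definition solve (p : seq unit * raw_input) : seq (seq (seq nat)) :=
  tables (tt :: p.1) [seq fraction_of_raw r | r <- p.2.1] [seq fraction_of_raw r | r <- p.2.2.1]
    [seq [seq fraction_of_raw r | r <- row] | row <- p.2.2.2.1].

Lemma fp_solve : fp solve.
Proof. by rewrite /solve /fraction_of_raw; apply: fp_tables; fp_go. Qed.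

Lemma solve_raw pad I eps : solve (pad, raw_input_of I eps) =
  tables (tt :: pad) (map fraction_of (Defs.val1 I)) (map fraction_of (Defs.val2 I))
    (map (map fraction_of) (pmf I)).
Proof.
rewrite /solve /=; congr tables; rewrite -?map_comp //.
by apply: eq_map => row /=; rewrite -map_comp.
Qed.

(** * Writing the rounded-up inverse of eps in unary *)

Section Padding.

Definition eps_num (x : raw_input) : nat := x.2.2.2.1.1.2.1.
Definition eps_den (x : raw_input) : nat := x.2.2.2.1.2.1.2.1.

(** The leading flag says k < 1 / eps in cross-multiplied form and is the loop test, visible in the
    first symbol. The product is stored so that a round only adds. *)
Definition pad_state k (x : raw_input) : bool * (nat * (seq unit * raw_input)) :=
  (k * eps_num x < eps_den x, (k * eps_num x, (nseq k tt, x))).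

Definition pad_step (z : bool * (nat * (seq unit * raw_input))) :
    bool * (nat * (seq unit * raw_input)) :=
  (z.2.1 + eps_num z.2.2.2 < eps_den z.2.2.2,
    (z.2.1 + eps_num z.2.2.2, (tt :: z.2.2.1, z.2.2.2))).

Definition pad_tape x (u v : seq unit) : tape := stk1 [::] (enc (pad_state (size u) x)).

Lemma fp_pad_step : fp pad_step.
Proof. by rewrite /pad_step /eps_num /eps_den; fp_go. Qed.

Lemma fp_pad_start : fp (pad_state 0).
Proof. by rewrite /pad_state /eps_num /eps_den; fp_go; apply: (fp_pair (fp_const _) fp_id). Qed.

Lemma pad_stepE k x : pad_step (pad_state k x) = pad_state k.+1 x.
Proof. by rewrite /pad_step /pad_state /= mulSn addnC. Qed.

Lemma size_enc_units k : size (enc (nseq k tt)) = k.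
Proof. by elim: k => // k IH; rewrite size_enc_cons IH. Qed.

Lemma size_eps_num x : size (enc (eps_num x)) <= size (enc x).
Proof. by rewrite /eps_num; case: x => a [b [c [[[s [p u]] d] e]]]; rewrite !size_encP /=; lia. Qed.

Lemma size_eps_den x : size (enc (eps_den x)) <= size (enc x).
Proof.
by rewrite /eps_den; case: x => a [b [c [[n [[s [q u]] d]] e]]]; rewrite !size_encP /=; lia.
Qed.

(** Until the loop stops, the stored product is smaller than numerator plus denominator of eps,
    hence at most one digit longer than the input. *)
Lemma size_pad_state K k x : (forall j, j < K -> j * eps_num x < eps_den x) -> k <= K ->
  size (enc (pad_state k x)) <= 10 * (size (enc x) + K) + 10.
Proof.
move=> hK kK.
have sz : size (enc (k * eps_num x)) <= (size (enc x)).+1.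
  rewrite size_enc_nat expnS mul2n -addnn.
  have h1 := leq_trans (ltn_size_enc (eps_num x)) (leq_pexp2l (isT : 0 < 2) (size_eps_num x)).
  have h2 := leq_trans (ltn_size_enc (eps_den x)) (leq_pexp2l (isT : 0 < 2) (size_eps_den x)).
  case: k kK => [|k] kK; first by rewrite mul0n; lia.
  by have := hK k kK; rewrite mulSn; lia.
rewrite /pad_state 3!size_encP /= size_enc_units.
by have := size_enc_bool (k * eps_num x < eps_den x); move: sz; lia.
Qed.

End Padding.

Section Main.

(* The padding loop is the only part whose running time is not bounded in terms of the input
   alone: it runs K times, where K is about 1 / eps. *)
Lemma solve_program : exists p c, forall x K,
  (forall k, k < K -> k * eps_num x < eps_den x) -> eps_den x <= K * eps_num x ->
  polyruns c (size (enc x) + K) p ([::], enc x +++ blanks)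
    (stk1 [::] (enc (solve (nseq K tt, x)))).
Proof.
have [p1 [c1 H1]] := fp_pad_start.
have [p2 [c2 H2]] := fp_pad_step.
have [p3 [c3 H3]] : fp (fun z : bool * (nat * (seq unit * raw_input)) => solve z.2.2).
  by apply: (fp_comp fp_solve); fp_go.
exists (Seq (Act id MoveL) (Seq mvR (Seq p1 (Seq (While not_sep p2) p3)))).
eexists => x K Klt Kge; set n := size (enc x) + K.
(* The initial tape has nothing to the left of the head; one step left and one step right create the
   blank that [stk1] has below its word. *)
apply: polyruns_seq; first exact: polyruns_act.
rewrite /act /= scons_eta.
apply: (@polyruns_seq _ _ _ _ _ _ (stk1 [::] (enc x))); first exact: polyruns_mvR.
apply: polyruns_seq; first by apply: polyruns_size (H1 _ _) _; exact: leq_addr.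
have ss : 10 * n + 10 <= n.+2 ^ 6.
  have : 2 ^ 4 <= n.+2 ^ 4 by rewrite leq_exp2r.
  by move=> h; rewrite -[6]/(4 + 2) expnD -[n.+2 ^ 2]/(n.+2 * n.+2); move: (n.+2 ^ 4) h => A; nia.
apply: (polyruns_scale _ ss).
pose J := pad_tape x.
apply: (@polyruns_seq _ _ _ _ _ _ (J (nseq K tt) [::])).
  refine (@polyruns_while _ _ _ J (nseq K tt) c2 _ _ _ _) => [|u a v uv|].
  - by rewrite size_nseq /n; lia.
  - have uK : size u < K by have := congr1 size uv; rewrite size_nseq size_cat /=; lia.
    split; first by rewrite /J /= prep_head /pad_state Klt.
    rewrite /J /pad_tape size_rcons -pad_stepE; apply: polyruns_size (H2 _ _) _.
    exact/size_pad_state/ltnW.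
  - by rewrite /J /= prep_head /pad_state size_nseq ltnNge Kge.
rewrite /J /pad_tape size_nseq; apply: polyruns_size (H3 _ _) _.
exact: size_pad_state.
Qed.

Lemma prep_nth w i : (w +++ blanks) i = nth Blank w i.
Proof. by elim: w i => [|a w IH] [|i] //=; apply: IH. Qed.

Lemma tm_output_word (s o : seq Sym) : clean o ->
  (forall i, nth Blank s i = (o +++ blanks) i) -> take (find is_blank s) s = o.
Proof.
elim: o s => [|b o IH] [|a s] //= co e.
- by have /= -> := e 0.
- by have /= e0 := e 0; move: co; rewrite -e0.
case/andP: co => nbb co; have /= -> := e 0.
rewrite (negPf nbb) /=; congr cons; apply: IH => // i.
exact: (e i.+1).
Qed.

Lemma polyruns_computes c s p w o : polyruns c s p ([::], w +++ blanks) (stk1 [::] o) ->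
  clean o -> exists2 t, t <= s.+2 ^ c & computes_within (compile p) w t o.
Proof.
case=> t le e co; exists t => //.
have [q r dq] := exec_reach e.
have rep0 : represents (init_config (compile p) w) (tm_start (compile p), ([::], w +++ blanks)).
  case: w {e r} => [|a w]; split=> // i; last exact: (esym (prep_nth (a :: w) i)).
  by case: i => [|i] //=; rewrite nth_nil.
have [rep h] := reach_run r rep0 dq; split=> //.
move: rep; case: (run _ _) h => -[[q' l] a] r' _ /= [_ _ eqR].
exact: (@tm_output_word (a :: r') o co eqR).
Qed.

Lemma exists_padding p q : 0 < p ->
  exists K, (forall k, k < K -> k * p < q) /\ q <= K * p.
Proof.
move=> p0; have ex : exists K, q <= K * p by exists q; rewrite leq_pmulr.
case: (ex_minnP ex) => K qK Kmin; exists K; split=> // k kK.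
by rewrite ltnNge; apply/negP => /Kmin; rewrite leqNgt kK.
Qed.

End Main.

Local Open Scope ring_scope.

Lemma padding_bounds (eps : rat) K : 0 < eps ->
  (forall k, (k < K)%N -> (k * `|numq eps| < `|denq eps|)%N) ->
  (`|denq eps| <= K * `|numq eps|)%N ->
  eps^-1 <= K%:R /\ K%:R <= 1 + eps^-1.
Proof.
move=> e0 Klt Kge.
have n0 : 0 < (`|numq eps|%N)%:R :> rat by rewrite ltr0n absz_gt0 numq_eq0 gt_eqF.
have eE : eps^-1 = (`|denq eps|%N)%:R / (`|numq eps|%N)%:R.
  by rewrite !natr_absz !ger0_norm ?numq_ge0 ?denq_ge0 ?ltW // -[in LHS](divq_num_den eps) invf_div.
rewrite eE; split; first by rewrite ler_pdivrMr // -natrM ler_nat.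
case: K Klt {Kge} => [|K] Klt; first by rewrite addr_ge0 ?divr_ge0 ?ler0n.
rewrite -natr1 addrC lerD2l ler_pdivlMr // -natrM ler_nat ltnW //.
exact: Klt.
Qed.

(** As n >= 1, one has n + K + 2 <= n + 3 + 1 / eps <= 4 (n + 1 / eps). One constant must serve as
    factor and as exponent, and 4 ^ c does both, since c <= 4 ^ c and the base is at least 1. *)
Lemma poly_time_bound (c n K t : nat) (eps : rat) : 0 < eps -> (0 < n)%N ->
  K%:R <= 1 + eps^-1 -> (t <= (n + K).+2 ^ c)%N ->
  t%:R <= (4 ^ c)%:R * (n%:R + eps^-1) ^+ (4 ^ c) :> rat.
Proof.
move=> e0 n0 Kle tle.
have ei : 0 < eps^-1 by rewrite invr_gt0.
have n1 : 1 <= n%:R :> rat by rewrite ler1n.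
have X1 : 1 <= n%:R + eps^-1 by lra.
apply: le_trans (_ : ((n + K).+2 ^ c)%:R <= _); first by rewrite ler_nat.
apply: le_trans (_ : (4 * (n%:R + eps^-1)) ^+ c <= _).
  rewrite natrX lerXn2r ?nnegrE ?ler0n //; first by lra.
  by rewrite -addn2 !natrD; lra.
rewrite exprMn natrX ler_wpM2l ?exprn_ge0 // ler_weXn2l //.
exact: ltnW (ltn_expl c _).
Qed.

Theorem theorem4p1 :
  exists (M : TM) (c : nat),
    forall (I : instance) (eps : rat),
      wf_instance I -> 0 < eps ->
      exists (t : nat) (P : seq mech),
        [/\ (t%:R <= c%:R * ((size (enc_input I eps))%:R + eps^-1) ^+ c :> rat),
            computes_within M (enc_input I eps) t (enc_output P) &
            eps_pareto_set I eps P].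
Proof.
have [p [c H]] := solve_program.
exists (compile p), (4 ^ c)%N => I eps wfI e0.
set x := raw_input_of I eps.
have p0 : (0 < eps_num x)%N by rewrite absz_gt0 numq_eq0 gt_eqF.
have [K [Klt Kge]] := exists_padding (eps_den x) p0.
have [Klo Khi] := padding_bounds e0 Klt Kge.
have [t tle comp] := polyruns_computes (H x K Klt Kge) (clean_enc _).
exists t, (solve (nseq K tt, x)); split.
- by rewrite enc_input_raw; apply: poly_time_bound e0 _ Khi tle; rewrite size_encP.
- by rewrite enc_input_raw enc_output_enc.
rewrite solve_raw; apply: tables_pareto => //.
by rewrite /= size_nseq -natr1; lra.
Qed.
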